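(* The expected rumor spreading time of the single incoming call pull protocol on the complete graph with $n$ vertices is $\log_{2-1/e} n+\log_2\ln n\pm O(1)$.
   Context: Single incoming call pull protocol on the complete graph with $n$ nodes: initially exactly one node is informed. In each round, every node that is uninformed at the beginning of the round (and no other node) calls a node chosen independently and uniformly at random from all $n$ nodes (including itself). Each node that receives at least one call in the round accepts exactly one of the calls it received, chosen uniformly at random among them (equivalently: a uniformly random permutation assigns distinct priorities to the calls and each node accepts the received call of lowest priority number); all other calls are dropped and have no effect. A caller whose call is accepted by a node that was informed at the beginning of the round is informed from the end of that round on. The rumor spreading time is the number of rounds until all nodes are informed. $\pm O(1)$ denotes a deviation bounded in absolute value by a constant independent of $n$, for all sufficiently large $n$. *)

(* Defs.v *)
From HB Require Import structures.
From mathcomp Require Import all_boot all_order all_algebra all_fingroup.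
From mathcomp Require Import all_classical all_reals all_analysis.

Set Implicit Arguments.
Unset Strict Implicit.
Unset Printing Implicit Defensive.

Import Order.TTheory GRing.Theory Num.Theory.

Local Open Scope ring_scope.

(* The randomness of one round: the node that each node would call if it were
   uninformed (entries of informed nodes are ignored), and the priorities of
   the calls; [r.2 v] is the priority number of the call placed by [v]. *)
Definition round (n : nat) : finType :=
  ({ffun 'I_n -> 'I_n} * {perm 'I_n})%type.

Section Protocol.
Variable n : nat.
Implicit Types (S : {set 'I_n}) (r : round n) (u v w : 'I_n).

Definition received S r u : {set 'I_n} := [set v in ~: S | r.1 v == u]%SET.

Definition accepted S r v : bool :=
  (v \in received S r (r.1 v)) &&
  [forall w in received S r (r.1 v), (r.2 v <= r.2 w)%N].

Definition step S r : {set 'I_n} :=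
  (S :|: [set v | accepted S r v & r.1 v \in S])%SET.

Fixpoint informed (v0 : 'I_n) (rs : nat -> round n) (t : nat) : {set 'I_n} :=
  if t is t'.+1 then step (informed v0 rs t') (rs t') else [set v0]%SET.

(* [ereal_inf] of the empty set is [+oo], the value taken when some node is
   never informed. *)
Definition spreading_time (R : realType) (v0 : 'I_n) (rs : nat -> round n)
    : \bar R :=
  ereal_inf [set (t%:R)%:E | t in
    [set t : nat | informed v0 rs t = [set: 'I_n]%SET]%classic]%classic.

End Protocol.

Section Independence.
Context (R : realType) (d : measure_display) (Omega : measurableType d).
Variables (P : probability Omega R) (A : finType) (X : nat -> Omega -> A).

Record iid_uniform : Prop := {
  iid_measurable : forall t (a : A),
    measurable (X t @^-1` [set a])%classic;
  iid_uniform_law : forall t (a : A),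
    P (X t @^-1` [set a])%classic = (#|A|%:R^-1)%:E;
  iid_independent : forall (J : seq nat) (B : nat -> {set A}), uniq J ->
    P [set w | forall t, t \in J -> X t w \in B t]%classic =
    (\prod_(t <- J) P [set w | X t w \in B t]%classic)%E }.

End Independence.

Definition expected_spreading_time (R : realType) (d : measure_display)
    (Omega : measurableType d) (P : probability Omega R) (n : nat)
    (v0 : 'I_n) (X : nat -> Omega -> round n) : \bar R :=
  (\int[P]_w spreading_time R v0 (fun t => X t w))%E.

Definition log_base (R : realType) (b x : R) : R := ln x / ln b.

(* Main.v *)
(* Each informed node that receives a call informs exactly one caller, so a
   round adds to the k informed nodes the number of them hit by the n - k calls.
   The number hit has mean k (1 - q) and variance at most k q (1 - q), where
   q = (1 - 1/n)^(n-k); the miss events of two nodes are negatively correlated.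

   The set of informed nodes is a Markov chain, and the expected spreading time
   is bounded by additive drift: if a potential h >= 0 of the number of informed
   nodes loses at least 1 per round on average, the expected time from one node
   is at most h 1; if it vanishes at n, is bounded, and loses at most c, the
   expected time is at least h 1 / c.

   For the upper bound, h is a sum of three monotone potentials, each with drift
   -1 in its own phase: roughly log_(2-1/e) (n/k) while a constant fraction is
   uninformed, then log_2 (ln n / ln (n/u)) for u = n - k uninformed nodes, as
   each round takes u/n to O((u/n)^2), then a multiple of the indicator of
   u > 0. For the lower bound the first two potentials are truncated so that
   they never decrease together; the second has drift at least
   -1 - O(n^(-1/4) ln n) by Chebyshev's inequality. *)
Require Import Defs.
From HB Require Import structures.
From mathcomp Require Import all_boot all_order all_algebra all_fingroup.
From mathcomp Require Import all_classical all_reals all_analysis.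
From mathcomp Require Import measurable_realfun ring lra zify.

Set Implicit Arguments.
Unset Strict Implicit.
Unset Printing Implicit Defensive.

Import Order.TTheory GRing.Theory Num.Theory.

Local Open Scope ring_scope.

(** * One round *)

Section CardStep.
Variable n : nat.
Implicit Types (S : {set 'I_n}) (r : round n) (f : {ffun 'I_n -> 'I_n}).

Definition missed S f : {set 'I_n} :=
  [set u in S | [forall v in ~: S, f v != u]]%SET.

Lemma stepT r : step [set: 'I_n]%SET r = [set: 'I_n]%SET.
Proof. by rewrite /step finset.setTU. Qed.

(** Calls match the newly informed nodes one to one with the informed nodes that are hit: two
    accepted calls to one node would both have lowest priority, and every hit node accepts the
    lowest call it gets. *)
Lemma card_step S r : (#|step S r| + #|missed S r.1| = #|S| + #|S|)%N.
Proof.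
pose New := [set v | accepted S r v & r.1 v \in S]%SET.
have imN : r.1 @: New = S :\: missed S r.1.
  apply/setP => u; apply/imsetP/idP => [[v]|].
    rewrite !inE => /andP[/andP[]]; rewrite !inE eqxx andbT => vS _ rS ->.
    rewrite rS andbT /=; apply/forallPn; exists v.
    by rewrite inE vS /= eqxx.
  rewrite !inE negb_and => /andP[+ uS]; rewrite uS /= => /forallPn[v0].
  rewrite negb_imply inE negbK => /andP[v0S /eqP v0u].
  have [|v vR vmin] := @arg_minnP _ v0 (mem (received S r u)) (fun v => r.2 v : nat).
    by rewrite !inE v0S v0u eqxx.
  have /[!inE] /andP[vS /eqP vu] := vR.
  exists v => //; rewrite !inE /accepted vu uS andbT; apply/andP; split.
    exact: vR.
  by apply/forall_inP => w wR; apply: vmin.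
have injN : {in New &, injective r.1}.
  move=> v w; rewrite !inE /accepted => /andP[/andP[vR /forall_inP vm] _].
  move=> /andP[/andP[wR /forall_inP wm] _] vw.
  apply/(@perm_inj _ r.2)/val_inj/anti_leq; rewrite vm ?vw //= wm // -vw //.
have dis : [disjoint S & New].
  rewrite finset.disjoints_subset; apply/fintype.subsetP => v vS.
  by rewrite !inE /accepted !inE vS.
have mS : missed S r.1 \subset S by apply/fintype.subsetP => v; rewrite inE => /andP[].
rewrite /step -/New cardsU (eqP (_ : S :&: New == finset.set0)%SET); last first.
  by rewrite finset.setI_eq0.
rewrite cards0 subn0 -(card_in_imset injN) imN cardsD (finset.setIidPr mS) -addnA.
by rewrite subnK // subset_leq_card.
Qed.

End CardStep.

(** * Mean and variance of the number of missed nodes *)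

Section Moments.
Context {R : realType}.
Variable n : nat.
Implicit Types (S : {set 'I_n}) (f : {ffun 'I_n -> 'I_n}).

Definition rmean (F : round n -> R) : R := (\sum_r F r) / #|{: round n}|%:R.

Lemma card_round_gt0 : (0 < #|{: round n}|)%N.
Proof. by apply/card_gt0P; exists ([ffun i => i], 1%g). Qed.

Lemma rmeanD F G : rmean (fun r => F r + G r) = rmean F + rmean G.
Proof. by rewrite /rmean big_split mulrDl. Qed.

Lemma rmeanZ c F : rmean (fun r => c * F r) = c * rmean F.
Proof. by rewrite /rmean -mulr_sumr mulrA. Qed.

Lemma rmean_cst c : rmean (fun=> c) = c.
Proof.
rewrite /rmean sumr_const -(mulr_natr c) mulfK // pnatr_eq0 -lt0n.
exact: card_round_gt0.
Qed.

Lemma le_rmean F G : (forall r, F r <= G r) -> rmean F <= rmean G.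
Proof.
by move=> FG; rewrite ler_wpM2r ?invr_ge0 ?ler0n //; apply: ler_sum.
Qed.

Lemma rmean_calls (F : {ffun 'I_n -> 'I_n} -> R) :
  rmean (fun r => F r.1) = (\sum_f F f) / n%:R ^+ n.
Proof.
rewrite /rmean -(pair_bigA _ (fun (f : {ffun 'I_n -> 'I_n}) (_ : {perm 'I_n}) => F f)) /=.
under eq_bigr => f _ do rewrite sumr_const -(mulr_natr (F f)).
rewrite -mulr_suml card_prod card_ffun card_ord natrM natrX.
have p0 : #|{perm 'I_n}|%:R != 0 :> R.
  by rewrite pnatr_eq0 -lt0n; apply/card_gt0P; exists 1%g.
by rewrite [n%:R ^+ n * _]mulrC invfM mulrA mulfK.
Qed.

(** Calls are independent, so the sum over all call functions of a product of indicators is a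
    product of sums; the factor [n] of each informed node cancels. *)
Lemma rmean_avoid S (B : {set 'I_n}) :
  rmean (fun r => [forall v in ~: S, r.1 v \notin B]%:R) =
  ((n - #|B|)%:R / n%:R) ^+ (n - #|S|).
Proof.
have [n0|n0] := posnP n.
  have -> : (n - #|S| = 0)%N by lia.
  rewrite expr0 -[RHS](rmean_cst 1); congr rmean; apply/funext => r.
  by case: forall_inP => // -[]; move=> v; exfalso; case: v => m; rewrite n0.
rewrite (rmean_calls (fun f => [forall v in ~: S, f v \notin B]%:R)).
transitivity ((\sum_(f : {ffun 'I_n -> 'I_n})
   \prod_v (((v \in ~: S) ==> (f v \notin B))%:R : R)) / n%:R ^+ n).
  congr (_ / _); apply: eq_bigr => f _.
  case: forallP => [H|/forallP H].
    by rewrite big1 // => v _; rewrite H.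
  move: H => /forallPn[v Hv]; rewrite (bigD1 v) //= (negbTE Hv) mul0r //.
rewrite -(bigA_distr_bigA (fun v w : 'I_n => (((v \in ~: S) ==> (w \notin B))%:R : R))).
rewrite (bigID (mem S)) /=.
rewrite (eq_bigr (fun=> n%:R)); last first.
  move=> v vS; under eq_bigr => w _ do rewrite inE vS /=.
  by rewrite sumr_const card_ord.
rewrite [X in _ * X / _](eq_bigr (fun=> (n - #|B|)%:R)); last first.
  move=> v vS; under eq_bigr => w _ do rewrite inE vS /=.
  have -> : (n - #|B| = #|~: B|)%N by rewrite [RHS]cardsCs finset.setCK card_ord.
  rewrite -sum1_card natr_sum [RHS]big_mkcond; apply: eq_bigr => w _.
  by rewrite finset.in_setC; case: (w \in B).
rewrite !prodr_const.
have -> : #|[pred i | i \notin S]| = (n - #|S|)%N.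
  by rewrite -[X in (X - _)%N]card_ord -(cardC (mem S)) addKn; apply: eq_card.
have -> : n%:R ^+ n = n%:R ^+ #|S| * n%:R ^+ (n - #|S|) :> R.
  by rewrite -exprD subnKC // -[leqRHS]card_ord max_card.
rewrite expr_div_n invfM mulrACA mulfV ?mul1r //.
by rewrite expf_eq0 pnatr_eq0 (gtn_eqF n0) andbF.
Qed.

(** Probability that a given informed node receives no call. *)
Definition miss S : R := (1 - n%:R^-1) ^+ (n - #|S|).

Lemma rmean_missed S : rmean (fun r => #|missed S r.1|%:R) = #|S|%:R * miss S.
Proof.
have [n0|n0] := posnP n.
  have S0 : (#|S| = 0)%N by apply/eqP; rewrite -leqn0 -n0 -[leqRHS]card_ord max_card.
  rewrite S0 mul0r -[RHS](rmean_cst 0); congr rmean; apply/funext => r.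
  apply/eqP; rewrite pnatr_eq0 -leqn0 -S0 subset_leq_card //.
  by apply/fintype.subsetP => v; rewrite inE => /andP[].
transitivity (\sum_(u in S) rmean (fun r => [forall v in ~: S, r.1 v \notin [set u]%SET]%:R)).
  rewrite /rmean -mulr_suml exchange_big /=; congr (_ / _); apply: eq_bigr => r _.
  rewrite -sum1_card natr_sum big_mkcond [RHS]big_mkcond; apply: eq_bigr => u _.
  rewrite /missed !inE; case: (u \in S) => //=.
  have -> : [forall v in ~: S, r.1 v \notin [set u]%SET] = [forall v in ~: S, r.1 v != u].
    by apply: eq_forallb => v; rewrite !inE.
  by case: ifP.
rewrite (eq_bigr (fun=> miss S)); last first.
  move=> u _; rewrite rmean_avoid cards1 /miss natrB // mulrBl mulfV ?mul1r //.
  by rewrite pnatr_eq0 -lt0n.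
by rewrite sumr_const mulr_natl.
Qed.

(** The square expands over pairs of informed nodes. Two distinct nodes are both missed with
    probability [(1 - 2/n)^(n-k)], at most [miss S ^+ 2] because [1 - 2/n <= (1 - 1/n)^2]. *)
Lemma rmean_missed_sqr S : (1 < n)%N ->
  rmean (fun r => #|missed S r.1|%:R ^+ 2) <=
  #|S|%:R * miss S + (#|S|%:R ^+ 2 - #|S|%:R) * miss S ^+ 2.
Proof.
move=> n1; have n0 : n%:R != 0 :> R by rewrite pnatr_eq0; lia.
have -> : rmean (fun r => #|missed S r.1|%:R ^+ 2) =
  \sum_(u in S) \sum_(w in S)
    rmean (fun r => [forall v in ~: S, r.1 v \notin [set u; w]%SET]%:R).
  rewrite /rmean.
  under [RHS]eq_bigr do rewrite -mulr_suml exchange_big.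
  rewrite -mulr_suml exchange_big /=; congr (_ / _); apply: eq_bigr => r _.
  have -> : #|missed S r.1|%:R = \sum_(u in S) [forall v in ~: S, r.1 v != u]%:R :> R.
    rewrite -sum1_card natr_sum big_mkcond [RHS]big_mkcond; apply: eq_bigr => u _.
    by rewrite /missed !inE; case: (u \in S) => //=; case: ifP.
  rewrite expr2 mulr_suml; apply: eq_bigr => u _.
  rewrite mulr_sumr; apply: eq_bigr => w _.
  rewrite -natrM mulnb; congr ((nat_of_bool _)%:R).
  apply/andP/forall_inP => [[/forall_inP H1 /forall_inP H2] v vS|H].
    by rewrite !inE negb_or H1 // H2.
  by split; apply/forall_inP => v vS; have := H v vS; rewrite !inE negb_or => /andP[].
have q2 : ((n - 2)%:R / n%:R) ^+ (n - #|S|) <= miss S ^+ 2 :> R.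
  rewrite /miss exprAC; apply: lerXn2r; rewrite ?nnegrE ?exprn_even_ge0 //.
  rewrite natrB // mulrBl mulfV //.
  have : 0 <= n%:R^-1 * n%:R^-1 :> R by rewrite mulr_ge0.
  nra.
apply: (@le_trans _ _ (\sum_(u in S) (miss S + (#|S|%:R - 1) * miss S ^+ 2))).
  apply: ler_sum => u uS; rewrite (bigD1 u) //=; apply: lerD.
    rewrite finset.setUid rmean_avoid cards1 /miss natrB ?(ltnW n1) //.
    by rewrite mulrBl mulfV ?mul1r.
  apply: (@le_trans _ _ (\sum_(w in S | w != u) miss S ^+ 2)).
    by apply: ler_sum => w /andP[_ wu]; rewrite rmean_avoid cards2 eq_sym wu.
  rewrite sumr_const -[leLHS]mulr_natl.
  suff -> : #|S|%:R - 1 = #|[pred w in S | w != u]|%:R :> R by [].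
  rewrite (cardD1 u) uS natrD addrC addKr; congr _%:R; apply: eq_card => w.
  by rewrite !inE andbC.
by rewrite sumr_const -[leLHS]mulr_natl mulrDr mulrA mulrBr mulr1 expr2.
Qed.

Lemma rmean_missed_var S : (1 < n)%N ->
  rmean (fun r => (#|missed S r.1|%:R - #|S|%:R * miss S) ^+ 2) <=
  #|S|%:R * miss S * (1 - miss S).
Proof.
move=> n1; have := rmean_missed_sqr S n1; have := rmean_missed S.
set k := #|S|%:R; set q := miss S => e1 e2.
have -> : (fun r : round n => (#|missed S r.1|%:R - k * q) ^+ 2) =
  (fun r => #|missed S r.1|%:R ^+ 2 + ((- (2 * (k * q))) * #|missed S r.1|%:R + (k * q) ^+ 2)).
  by apply/funext => r; ring.
rewrite rmeanD rmeanD rmeanZ rmean_cst e1; lra.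
Qed.

End Moments.

(** * The Markov chain of informed sets and additive drift *)

Section SpreadingTime.
Context {R : realType}.
Variables (n : nat) (v0 : 'I_n).
Implicit Types (rs : nat -> round n) (t : nat).
Local Open Scope ereal_scope.

Lemma informedT_mono rs t s : (t <= s)%N ->
  informed v0 rs t = [set: 'I_n]%SET -> informed v0 rs s = [set: 'I_n]%SET.
Proof.
move=> /subnK <-; elim: (s - t)%N => [//|m IH] /IH /= ->; exact: stepT.
Qed.

(** The full set is absorbing, so the first full time equals the number of non-full times; if no
    time is full, both sides are [+oo]. *)
Lemma spreading_timeE rs : spreading_time R v0 rs =
  \sum_(t <oo) ((informed v0 rs t != [set: 'I_n]%SET)%:R : R)%:E.
Proof.
set f := fun t => ((informed v0 rs t != [set: 'I_n]%SET)%:R : R)%:E.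
have f0 t : 0 <= f t by rewrite lee_fin.
have sum_full s N : (N <= s)%N -> informed v0 rs s = [set: 'I_n]%SET ->
    (forall j, (j < s)%N -> informed v0 rs j != [set: 'I_n]%SET) ->
    \sum_(0 <= t < N) f t = N%:R%:E.
  move=> Ns _ H; rewrite big_nat (eq_bigr (fun=> 1)); last first.
    by move=> j /andP[_ jN]; rewrite /f H // (leq_trans jN).
  by rewrite -big_nat sumEFin sumr_const_nat subn0.
apply/eqP; rewrite eq_le; apply/andP; split.
- have [[t0 ft0]|nofull] :=
    pselect (exists t, informed v0 rs t == [set: 'I_n]%SET); last first.
    have -> : \sum_(t <oo) f t = +oo; last exact: leey.
    apply: eq_infty => r; apply: (@le_trans _ _ (Num.truncn r).+1%:R%:E).
      by rewrite lee_fin ltW // truncnS_gt.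
    apply: le_trans (nneseries_lim_ge (Num.truncn r).+1 (fun t _ _ => f0 t)).
    rewrite (eq_bigr (fun=> 1)) => [|j _]; last first.
      by rewrite /f; case: eqP => // /eqP jT; exfalso; apply: nofull; exists j.
    by rewrite sumEFin sumr_const_nat subn0.
  have [s /eqP sT smin] :=
    ex_minnP (ex_intro (fun t => informed v0 rs t == [set: 'I_n]%SET) t0 ft0).
  apply: ge_ereal_inf; exists s%:R%:E; first by exists s.
  apply: le_trans (nneseries_lim_ge s (fun t _ _ => f0 t)).
  rewrite (sum_full s s) // => j js; apply/negP => /smin.
  by rewrite leqNgt js.
- apply: le_ereal_inf_tmp => _ [s sT <-].
  apply: lime_le; first by apply: is_cvg_nneseries => t _ _; exact: f0.
  apply: nearW => N; apply: (@le_trans _ _ (\sum_(0 <= t < N) (t < s)%N%:R%:E)).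
    apply: lee_sum => t _; rewrite lee_fin ler_nat.
    case: ltnP => [_|st]; first exact: leq_b1.
    by rewrite (informedT_mono st sT) eqxx.
  rewrite sumEFin lee_fin -natr_sum ler_nat.
  suff -> : (\sum_(0 <= t < N) (t < s) = minn N s)%N by rewrite geq_minr.
  elim: N => [|N IH]; first by rewrite big_nil min0n.
  by rewrite big_nat_recr //= IH; case: (ltnP N s) => /=; lia.
Qed.

End SpreadingTime.

(** * Distribution of the chain and additive drift *)

Section Law.
Context {R : realType}.
Variables (n : nat) (v0 : 'I_n).
Implicit Types (S : {set 'I_n}) (r : round n).

(** Law of the informed set after [t] rounds, given by the transition recursion alone; [event_prob]
    links it to the probability space. *)
Fixpoint law t S : R :=
  if t is t'.+1
  then \sum_S' law t' S' * rmean (fun r => (step S' r == S)%:R)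
  else (S == [set v0]%SET)%:R.

Lemma law_ge0 t S : 0 <= law t S.
Proof.
elim: t S => [|t IH] S /=; first exact: ler0n.
apply: sumr_ge0 => S' _; rewrite mulr_ge0 // -(rmean_cst n 0).
by apply: le_rmean => r.
Qed.

Lemma sum_law f t :
  \sum_S law t.+1 S * f S = \sum_S law t S * rmean (fun r => f (step S r)).
Proof.
under eq_bigr => S _ do rewrite /= mulr_suml.
rewrite exchange_big /=; apply: eq_bigr => S' _.
under eq_bigr => S _ do rewrite -mulrA.
rewrite -mulr_sumr; congr (_ * _).
rewrite /rmean; under eq_bigr => S _ do rewrite mulrAC mulr_suml.
rewrite -mulr_suml exchange_big /=; congr (_ / _); apply: eq_bigr => r _.
rewrite (bigD1 (step S' r)) //= eqxx mul1r big1 ?addr0 // => S.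
by rewrite eq_sym => /negbTE ->; rewrite mul0r.
Qed.

Lemma sum_law0 f : \sum_S law 0 S * f S = f [set v0]%SET.
Proof.
rewrite (bigD1 [set v0]%SET) //= eqxx mul1r big1 ?addr0 // => S.
by move/negbTE ->; rewrite mul0r.
Qed.

Lemma sum_law1 t : \sum_S law t S = 1.
Proof.
suff : \sum_S law t S * 1 = 1 by under eq_bigr do rewrite mulr1.
elim: t => [|t IH]; first exact: (sum_law0 (fun=> 1)).
by rewrite (sum_law (fun=> 1)) rmean_cst.
Qed.

(** The start node stays informed; this is why drift conditions on nonempty sets suffice. *)
Lemma law_eq0 t S : v0 \notin S -> law t S = 0.
Proof.
elim: t S => [|t IH] S v0S /=.
  by case: eqP v0S => // ->; rewrite finset.in_set1 eqxx.
apply: big1 => S' _; have [v0S'|/IH ->] := boolP (v0 \in S'); last by rewrite mul0r.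
rewrite (_ : (fun r => _) = (fun=> 0)) ?rmean_cst ?mulr0 //; apply/funext => r.
by case: eqP v0S => // <-; rewrite finset.in_setU v0S'.
Qed.

Definition tail t : R := 1 - law t [set: 'I_n]%SET.

Lemma tailE t : tail t = \sum_S law t S * (S != [set: 'I_n]%SET)%:R.
Proof.
rewrite /tail -{1}(sum_law1 t) (bigD1 [set: 'I_n]%SET) //= [X in X - _]addrC addrK.
rewrite [RHS](bigD1 [set: 'I_n]%SET) //= eqxx mulr0 add0r.
by apply: eq_bigr => S ->; rewrite mulr1.
Qed.

Lemma tail_ge0 t : 0 <= tail t.
Proof. by rewrite tailE sumr_ge0 // => S _; rewrite mulr_ge0 ?law_ge0. Qed.

Lemma ler_sum_law f g t :
  (forall S, v0 \in S -> f S <= g S) ->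
  \sum_S law t S * f S <= \sum_S law t S * g S.
Proof.
move=> fg; apply: ler_sum => S _; have [v0S|v0S] := boolP (v0 \in S).
  by rewrite ler_wpM2l ?law_ge0 ?fg.
by rewrite law_eq0 // !mul0r.
Qed.

Lemma cardT_neq S : (S != [set: 'I_n]%SET) = (#|S| < n)%N.
Proof. by rewrite eqEcard finset.subsetT finset.cardsT card_ord ltnNge. Qed.

(** The mean potential drops by at least [tail t] in round [t], as the full set stays put, and it
    remains nonnegative: the drops telescope to at most [h 1]. *)
Lemma sum_tail_le (h : nat -> R) N :
  (forall S, (0 < #|S|)%N -> 0 <= h #|S|) ->
  (forall S, (0 < #|S| < n)%N -> rmean (fun r => h #|step S r|) <= h #|S| - 1) ->
  \sum_(t < N) tail t <= h 1.
Proof.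
move=> h0 drift.
have card0 S : v0 \in S -> (0 < #|S|)%N by move=> v0S; apply/card_gt0P; exists v0.
suff : \sum_(t < N) tail t <= h 1 - \sum_S law N S * h #|S|.
  move/le_trans; apply; rewrite lerBlDr lerDl.
  have {1}-> : 0 = \sum_S law N S * 0 by rewrite big1 // => S _; rewrite mulr0.
  exact: (@ler_sum_law (fun=> 0) _ N (fun S vS => h0 S (card0 S vS))).
elim: N => [|N IH].
  by rewrite big_ord0 (sum_law0 (fun S => h #|S|)) finset.cards1 subrr.
rewrite big_ord_recr /= (sum_law (fun S => h #|S|)).
have : \sum_S law N S * rmean (fun r => h #|step S r|) <=
       \sum_S law N S * (h #|S| - (S != [set: 'I_n]%SET)%:R).
  apply: ler_sum_law => S /card0 S0; rewrite cardT_neq.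
  case: ltnP => Sn; first by rewrite drift ?S0.
  have -> : S = [set: 'I_n]%SET by apply/eqP; rewrite -[_ == _]negbK cardT_neq -leqNgt.
  by rewrite (_ : (fun r => _) = (fun=> h #|[set: 'I_n]%SET|)) ?rmean_cst ?subr0 //;
    apply/funext => r; rewrite stepT.
under [X in _ <= X -> _]eq_bigr do rewrite mulrBr.
rewrite sumrB -tailE; lra.
Qed.

(** The same telescoping, reversed. The mean potential left at time [N] is at most [M * tail N],
    because [h n = 0]. *)
Lemma sum_tail_ge (h : nat -> R) (c M : R) N : h n = 0 ->
  (forall S, (0 < #|S|)%N -> h #|S| <= M) ->
  (forall S, (0 < #|S| < n)%N -> h #|S| - c <= rmean (fun r => h #|step S r|)) ->
  h 1 <= c * (\sum_(t < N) tail t) + M * tail N.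
Proof.
move=> hn hM drift.
have card0 S : v0 \in S -> (0 < #|S|)%N by move=> v0S; apply/card_gt0P; exists v0.
have notT S : (#|S| < n)%N = false -> S = [set: 'I_n]%SET.
  by move=> Sn; apply/eqP; rewrite -[_ == _]negbK cardT_neq Sn.
suff : h 1 - \sum_S law N S * h #|S| <= c * \sum_(t < N) tail t.
  suff : \sum_S law N S * h #|S| <= M * tail N by lra.
  rewrite tailE mulr_sumr; under [leRHS]eq_bigr do rewrite mulrCA.
  apply: ler_sum_law => S /card0 S0; rewrite cardT_neq.
  case: ltnP => Sn; first by rewrite mulr1 hM.
  by rewrite (notT S) ?cardsT ?card_ord ?hn ?mulr0 // ltnNge Sn.
elim: N => [|N IH].
  by rewrite big_ord0 (sum_law0 (fun S => h #|S|)) finset.cards1 subrr mulr0.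
rewrite big_ord_recr /= (sum_law (fun S => h #|S|)).
have : \sum_S law N S * (h #|S| - c * (S != [set: 'I_n]%SET)%:R) <=
       \sum_S law N S * rmean (fun r => h #|step S r|).
  apply: ler_sum_law => S /card0 S0; rewrite cardT_neq.
  case: ltnP => Sn; first by rewrite mulr1 drift ?S0.
  rewrite (notT S) ?ltnNge ?Sn //.
  by rewrite (_ : (fun r => _) = (fun=> h #|[set: 'I_n]%SET|)) ?rmean_cst ?mulr0 ?subr0 //;
    apply/funext => r; rewrite stepT.
under [X in X <= _ -> _]eq_bigr do rewrite mulrBr mulrCA.
rewrite sumrB -mulr_sumr -tailE; lra.
Qed.

End Law.

(** * From the chain to the given probability space *)

Section Probability.
Context {R : realType} {d : measure_display} {Omega : measurableType d}.
Variables (P : probability Omega R) (n : nat) (v0 : 'I_n).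
Variable X : nat -> Omega -> round n.
Hypothesis iidX : iid_uniform P X.
Local Open Scope classical_set_scope.

Lemma measure_fin_partition (I : finType) (F : I -> set Omega) :
  (forall i, measurable (F i)) -> trivIset setT F ->
  P (\bigcup_i F i) = (\sum_i P (F i))%E.
Proof.
move=> mF tF; rewrite measure_fin_bigcup //; last exact: finite_finset.
rewrite [RHS]fsbig_seq ?index_enum_uniq //; apply: eq_fsbigl.
by apply/seteqP; split => i //= _; rewrite mem_index_enum.
Qed.

(** Prescribing also the next [m] rounds makes the induction on [t] close: the event at [t.+1]
    splits over the previous set and round [t], which becomes the first prescribed round. *)
Let event t S m (b : nat -> round n) : set Omega :=
  [set w | informed v0 (X^~ w) t = S /\ forall j, (j < m)%N -> X (t + j)%N w = b j].

Let piece t S m b (p : {set 'I_n} * round n) : set Omega :=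
  if step p.1 p.2 == S
  then event t p.1 m.+1 (fun j => if j is j'.+1 then b j' else p.2) else set0.

Let eventS t S m b : event t.+1 S m b = \bigcup_p piece t S m b p.
Proof.
apply/seteqP; split => [w [wS wb]|w [[S' r] _]].
  exists (informed v0 (X^~ w) t, X t w) => //.
  rewrite /piece /= (_ : step _ _ == S); last by apply/eqP.
  by split => // -[|j] jm; rewrite ?addn0 // addnS -addSn wb.
rewrite /piece /=; case: eqP => // rS [tS tb]; split.
  by rewrite /= tS; have := tb 0%N isT; rewrite addn0 => ->.
by move=> j jm; rewrite addSn -addnS (tb j.+1).
Qed.

Let measurable_event t S m b : measurable (event t S m b).
Proof.
elim: t S m b => [|t IH] S m b; last first.
  rewrite eventS; apply: fin_bigcup_measurable => [|p _]; first exact: finite_finset.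
  by rewrite /piece; case: ifP.
have [vS|vS] := pselect ([set v0]%SET = S); last first.
  by rewrite (_ : event _ _ _ _ = set0) //; apply/seteqP; split => // w [].
rewrite (_ : event _ _ _ _ = \bigcap_(j in `I_m) (X j @^-1` [set b j])).
  by apply: bigcap_measurableType => j _; apply: iid_measurable iidX _ _.
by apply/seteqP; split => [w [_ H] j jm|w H]; [exact: H|split => // j /H].
Qed.

(** Past and future factor, since the set at time [t] depends only on the first [t] rounds. The base
    case is independence of the first [m] rounds. *)
Lemma event_prob t S m b :
  P (event t S m b) = (law v0 t S * #|{: round n}|%:R ^- m)%:E.
Proof.
elim: t S m b => [|t IH] S m b.
  rewrite /=; case: eqP => [->|vS]; last first.
    rewrite (_ : event _ _ _ _ = set0) ?measure0 ?mul0r //.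
    by apply/seteqP; split => // w [/esym].
  rewrite mul1r (_ : event _ _ _ _ =
    [set w | forall j, j \in iota 0 m -> X j w \in [set b j]%SET]); last first.
    apply/seteqP; split => [w [_ H] j|w H].
      by rewrite mem_iota /= add0n finset.in_set1 => /H ->.
    split => // j jm; apply/eqP; rewrite -finset.in_set1.
    by apply: H; rewrite mem_iota.
  rewrite (iid_independent iidX) ?iota_uniq //.
  rewrite (eq_bigr (fun=> (#|{: round n}|%:R^-1)%:E)); last first.
    move=> j _; rewrite -(iid_uniform_law iidX j (b j)); congr (P _).
    by apply/seteqP; split => w /=; rewrite finset.in_set1 => /eqP.
  rewrite prodEFin big_const_seq count_predT size_iota iter_mulr mulr1.
  by rewrite exprVn.
rewrite eventS measure_fin_partition; last 2 first.
- by move=> p; rewrite /piece; case: ifP.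
- apply/trivIsetP => -[S1 r1] [S2 r2] _ _ ne; apply/seteqP; split => // w [].
  rewrite /piece /=; case: eqP => // _; case: eqP => // _ [e1 b1] [e2 b2].
  case/eqP: ne; congr pair; first by rewrite -e1.
  by have := b1 0%N isT; have := b2 0%N isT => /= <- ->.
rewrite (eq_bigr (fun p => (law v0 t p.1 * (step p.1 p.2 == S)%:R *
   #|{: round n}|%:R ^- m.+1)%:E)); last first.
  move=> p _; rewrite /piece; case: ifP => _; first by rewrite IH mulr1.
  by rewrite measure0 mulr0 mul0r.
rewrite sumEFin -mulr_suml exprS invfM; congr EFin; rewrite mulrA; congr (_ * _).
rewrite -(pair_bigA _ (fun S' r => law v0 t S' * (step S' r == S)%:R)) /= mulr_suml.
by apply: eq_bigr => S' _; rewrite -mulr_sumr mulrA.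
Qed.

Lemma expected_spreading_timeE :
  expected_spreading_time P v0 X = (\sum_(t <oo) (tail v0 t)%:E)%E.
Proof.
rewrite /expected_spreading_time.
pose full t := [set w | informed v0 (X^~ w) t = [set: 'I_n]%SET].
have fullE t : full t = event t [set: 'I_n]%SET 0 (X^~ point).
  by apply/seteqP; split => w /=; [move=> ?; split|case].
have mfull t : measurable (full t) by rewrite fullE.
transitivity (\int[P]_w \sum_(t <oo) (\1_(~` full t) w : R)%:E)%E.
  apply: eq_integral => w _; rewrite spreading_timeE; congr (limn _); apply/funext => N.
  apply: eq_bigr => t _; rewrite indicE; congr ((_%:R)%:E).
  by case: eqP => [e|e] /=; [rewrite memNset // => /(_ e)|rewrite mem_set].
rewrite integral_nneseries //; last first.
  by move=> t; apply/measurable_EFinP/measurable_indic/measurableC.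
congr (limn _); apply/funext => N; apply: eq_bigr => t _.
rewrite integral_indic //; last exact: measurableC.
rewrite setIT; apply: etrans (probability_setC P (mfull t)) _.
by rewrite fullE event_prob expr0 invr1 mulr1 EFinB.
Qed.

Lemma expected_spreading_time_bounds (h g : nat -> R) (c M : R) :
  (forall S : {set 'I_n}, (0 < #|S|)%N -> 0 <= h #|S|) ->
  (forall S : {set 'I_n}, (0 < #|S| < n)%N ->
     rmean (fun r => h #|step S r|) <= h #|S| - 1) ->
  g n = 0 -> 0 <= c ->
  (forall S : {set 'I_n}, (0 < #|S|)%N -> g #|S| <= M) ->
  (forall S : {set 'I_n}, (0 < #|S| < n)%N ->
     g #|S| - c <= rmean (fun r => g #|step S r|)) ->
  exists e : R, [/\ expected_spreading_time P v0 X = e%:E, e <= h 1 & g 1 <= c * e].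
Proof.
move=> h0 hd gn c0 gM gd; rewrite expected_spreading_timeE.
have tail0 t : (0 <= (tail v0 t)%:E :> \bar R)%E by rewrite lee_fin tail_ge0.
have ub : (\sum_(t <oo) (tail v0 t)%:E <= (h 1)%:E)%E.
  apply: lime_le; first by apply: is_cvg_nneseries.
  by apply: nearW => N; rewrite sumEFin big_mkord lee_fin sum_tail_le.
have lb N : ((\sum_(t < N) (tail v0 t : R))%:E <= \sum_(t <oo) (tail v0 t)%:E)%E.
  apply: le_trans (nneseries_lim_ge N (fun t _ _ => tail0 t)).
  by rewrite sumEFin big_mkord.
have [e eE] : exists e : R, (\sum_(t <oo) (tail v0 t)%:E = e%:E)%E.
  exists (fine (\sum_(t <oo) (tail v0 t)%:E)%E); rewrite fineK // ge0_fin_numE.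
    by rewrite (le_lt_trans ub) // ltry.
  exact: nneseries_ge0.
exists e; rewrite eE; split => //; first by rewrite -lee_fin -eE.
(* A gap [g 1 - c * e > 0] would bound [M * tail N] from below for every [N], contradicting that the
   tails sum to [e]. *)
rewrite leNgt; apply/negP => lt.
have le_e N : \sum_(t < N) (tail v0 t : R) <= e by rewrite -lee_fin -eE.
set dl := g 1 - c * e.
have dl0 : 0 < dl by rewrite subr_gt0.
have tM N : dl <= M * tail v0 N.
  have := sum_tail_ge v0 N gn gM gd.
  have := ler_wpM2l c0 (le_e N); rewrite /dl; lra.
have M0 : 0 <= M.
  rewrite leNgt; apply/negP => M0; have := tM 0%N; have := tail_ge0 (R := R) v0 0; nra.
have NM N : N%:R * dl <= M * e.
  apply: le_trans (ler_wpM2l M0 (le_e N)); rewrite mulr_sumr.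
  apply: (@le_trans _ _ (\sum_(t < N) dl)); last exact: ler_sum.
  by rewrite sumr_const card_ord mulr_natl.
have := NM (Num.truncn (M * e / dl)).+1.
by rewrite -ler_pdivlMr // leNgt truncnS_gt.
Qed.

End Probability.

(** * Elementary inequalities *)

Section RealInequalities.
Context {R : realType}.
Implicit Types a t x y z m s : R.

Lemma ln_le_tangent a y : 0 < a -> 0 < y -> ln y <= ln a + (y - a) / a.
Proof.
move=> a0 y0; rewrite mulrBl mulfV ?gt_eqF // -lerBlDl -ln_div ?posrE //.
have {1}-> : y / a = 1 + (y / a - 1) by ring.
apply: le_ln1Dx.
by rewrite ltrBrDl subrr divr_gt0.
Qed.

Lemma ln_ge1V y : 0 < y -> 1 - y^-1 <= ln y.
Proof.
move=> y0; have := @ln_le_tangent y 1 y0 ltr01.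
by rewrite ln1 mulrBl mul1r mulfV ?gt_eqF //; lra.
Qed.

Lemma ln2_ge : 1 / 2 <= ln 2 :> R.
Proof. by have := @ln_ge1V 2 ltac:(lra); lra. Qed.

Lemma ln4E : ln 4 = 2 * ln 2 :> R.
Proof. by rewrite (_ : 4 = 2 ^+ 2) ?lnXn ?mulr_natl //; ring. Qed.

Lemma ln4_ge1 : 1 <= ln 4 :> R.
Proof. by rewrite ln4E; have := ln2_ge; lra. Qed.

Lemma le1_ln y : 4 <= y -> 1 <= ln y.
Proof. by move=> y4; apply: le_trans ln4_ge1 _; rewrite ler_ln ?posrE; lra. Qed.

(** This is the tangent of [ln] at [1 + z], read at [1 + m]. The quadratic error lets a variance
    bound control the mean of a logarithm from below. *)
Lemma ln_ge_quad z m : 0 <= z -> 0 <= m ->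
  ln (1 + m) + (z - m) / (1 + m) - (z - m) ^+ 2 <= ln (1 + z).
Proof.
move=> z0 m0; have z1 : 0 < 1 + z by lra.
have m1 : 0 < 1 + m by lra.
have := ln_le_tangent z1 m1.
suff : (z - m) / (1 + m) - (z - m) ^+ 2 <= - ((1 + m - (1 + z)) / (1 + z)) by lra.
have -> : - ((1 + m - (1 + z)) / (1 + z)) =
  (z - m) / (1 + m) - (z - m) ^+ 2 / ((1 + m) * (1 + z)).
  by field; rewrite ?gt_eqF.
rewrite lerD2l lerN2 ler_pdivrMr ?mulr_gt0 // ler_peMr ?sqr_ge0 //; nra.
Qed.

Lemma expR_ge_cubic s : 0 <= s -> (1 + s / 3) ^+ 3 <= expR s.
Proof.
move=> s0; have -> : expR s = expR (s / 3) ^+ 3 by rewrite -expRM_natl; congr expR; lra.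
by apply: lerXn2r; rewrite ?nnegrE ?expR_ge0 ?expR_ge1Dx //; lra.
Qed.

Lemma expR_ge_sqr s : 0 <= s -> 1 + s + s ^+ 2 / 4 <= expR s.
Proof.
move=> s0; have -> : expR s = expR (s / 2) ^+ 2 by rewrite -expRM_natl; congr expR; lra.
rewrite (_ : 1 + s + s ^+ 2 / 4 = (1 + s / 2) ^+ 2); last by field.
by apply: lerXn2r; rewrite ?nnegrE ?expR_ge0 ?expR_ge1Dx //; lra.
Qed.

Lemma bernoulli_ineq a (m : nat) : 0 <= a <= 1 -> 1 - m%:R * a <= (1 - a) ^+ m.
Proof.
move=> a01; elim: m => [|m IH]; first by rewrite mul0r subr0 expr0.
rewrite exprS -natr1; have m0 : 0 <= m%:R :> R by rewrite ler0n.
have : (1 - a) * (1 - m%:R * a) <= (1 - a) * (1 - a) ^+ m by rewrite ler_wpM2l //; lra.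
have : 0 <= m%:R * (a * a) by rewrite !mulr_ge0 //; lra.
by nra.
Qed.

(* Stands in for the concavity of [t |-> - ln (L - ln t)]: a random [t] of
   mean at most [1 / 4] has [- ln (L - ln t)] of mean at most [- ln L]. *)
Lemma lnln_le_linear (L t : R) : 0 < t -> 1 <= L -> 1 <= L - ln t ->
  - ln (L - ln t) <= - ln L + (2 * t - 1 / 2) / L.
Proof.
move=> t0 L1; set L' := L - ln t => L'1.
have L0 : 0 < L by lra.
have L'0 : 0 < L' by lra.
have L'E : L' = L - ln t by [].
clearbody L'.
have [t1|t1] := leP 1 t.
  have s0 : 0 <= ln t by rewrite ln_ge0.
  have := @ln_le_tangent L' L L'0 L0.
  suff : (L - L') / L' <= (2 * t - 1 / 2) / L by lra.
  have tE : t = expR (ln t) by rewrite lnK ?posrE.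
  have := expR_ge_cubic s0; rewrite -tE.
  set s := ln t in L'E s0 *; move=> cub.
  (* Since [1 <= L - s], the product [(s + s ^+ 2) * (L - s)] is at least [s * L], so this bound is
     enough. *)
  have quad : s + s ^+ 2 <= 2 * t - 1 / 2.
    have : 0 <= 3 / 2 + s - s ^+ 2 / 3 + 2 / 27 * s ^+ 3.
      (* Times [2 / 27], it has the cubic and quadratic terms of the goal; the remaining terms are
         positive. *)
      have : 0 <= s * (s - 9 / 4) ^+ 2 by rewrite mulr_ge0 ?sqr_ge0.
      by lra.
    have : (1 + s / 3) ^+ 3 = 1 + s + s ^+ 2 / 3 + s ^+ 3 / 27 by field.
    by lra.
  rewrite ler_pdivrMr // mulrAC ler_pdivlMr // L'E.
  apply: (@le_trans _ _ ((s + s ^+ 2) * (L - s))); last first.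
    by apply: ler_wpM2r quad; rewrite -L'E ltW.
  have -> : L - (L - s) = s by ring.
  have : 0 <= s * s * (L - s - 1) by rewrite mulr_ge0 ?mulr_ge0; lra.
  by lra.
have ln0 : ln t <= 0 by apply: ln_le0; exact: ltW.
have [t4|t4] := leP (1 / 4) t.
  have : 0 <= (2 * t - 1 / 2) / L by rewrite divr_ge0; lra.
  have : ln L <= ln L' by rewrite ler_ln ?posrE; lra.
  by lra.
(* For [t < 1 / 4] the increase [L' - L = - ln t] is at least 1, so [1 - L / L'] is at least
   [1 / (2 * L)]. *)
have r1 : 1 <= - ln t.
  rewrite -lnV ?posrE //; apply: le1_ln.
  by rewrite -[leLHS]invrK lef_pV2 ?posrE; lra.
have := @ln_ge1V (L' / L) (divr_gt0 L'0 L0); rewrite ln_div ?posrE // invf_div.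
suff : (1 / 2 - 2 * t) / L <= 1 - L / L'.
  by rewrite (_ : (1 / 2 - 2 * t) / L = - ((2 * t - 1 / 2) / L)); [lra|field; lra].
apply: (@le_trans _ _ (1 / 2 / L)); first by rewrite ler_wpM2r ?invr_ge0; lra.
have -> : 1 - L / L' = (L' - L) / L' by rewrite mulrBl mulfV // gt_eqF.
rewrite ler_pdivrMr // mulrAC ler_pdivlMr // L'E.
have : 0 <= (L - 1) * (- ln t - 1) by rewrite mulr_ge0; lra.
by lra.
Qed.

End RealInequalities.

(** * Bounds on the miss probability *)

Section MissBounds.
Context {R : realType}.
Variables (n : nat) (S : {set 'I_n}).
Hypotheses (n1 : (1 < n)%N) (S0 : (0 < #|S| < n)%N).
Let N : R := n%:R.
Let k : R := #|S|%:R.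
Let q : R := miss S.
Let x : R := (N - k) / N.

Let N1 : 1 < N. Proof. by rewrite /N ltr1n. Qed.
Let N0 : 0 < N. Proof. by rewrite (lt_trans _ N1). Qed.
Let V01 : 0 < N^-1 < 1.
Proof. by rewrite invr_gt0 N0 invf_lt1. Qed.
Let uE : (n - #|S|)%:R = N - k.
Proof. by case/andP: S0 => _ /ltnW kn; rewrite natrB. Qed.

Lemma miss_ge_lin : 1 - x <= q.
Proof.
rewrite /x -uE; apply: bernoulli_ineq; have := V01; lra.
Qed.

Lemma miss_le_expR : q <= expR (- x).
Proof.
have -> : expR (- x) = expR (- N^-1) ^+ (n - #|S|).
  by rewrite -expRM_natl uE; congr expR; rewrite /x mulrN.
have := V01 => V; apply: lerXn2r; rewrite ?nnegrE ?expR_ge0 //; first by lra.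
exact: expR_ge1Dx.
Qed.

Lemma x_bounds : 0 < x < 1.
Proof.
case/andP: S0 => k0 kn; rewrite /x divr_gt0 ?subr_gt0 ?ltr_nat //=.
by rewrite ltr_pdivrMr // mul1r ltrBlDr ltrDl ltr0n.
Qed.

Lemma hit_ge : x / (1 + x) <= 1 - q.
Proof.
have := x_bounds => x01; have x1 : 0 < 1 + x by lra.
have -> : x / (1 + x) = 1 - (1 + x)^-1 by field; lra.
rewrite lerD2l lerN2; apply: le_trans miss_le_expR _.
by rewrite expRN lef_pV2 ?posrE ?expR_gt0 ?expR_ge1Dx.
Qed.

Lemma miss_bounds : 0 <= q <= 1.
Proof.
have := V01 => V; apply/andP; split; first by apply: exprn_ge0; lra.
by apply: exprn_ile1; lra.
Qed.

(** At most [n - 1] nodes call, and [1 - 1/n] is the inverse of [1 + 1/(n-1)], which is at most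
    [expR (1/(n-1))]. *)
Lemma miss_ge_expR1 : (expR 1)^-1 <= q.
Proof.
case/andP: S0 => k0 kn; have := V01 => V.
apply: (@le_trans _ _ ((1 - N^-1) ^+ n.-1)); last first.
  by apply: ler_wiXn2l; [lra|lra|lia].
have nE : n.-1%:R = N - 1 by rewrite -subn1 natrB // ltnW.
have -> : 1 - N^-1 = (1 + (N - 1)^-1)^-1.
  have := N1 => N1'; field; rewrite ?gt_eqF //; lra.
rewrite exprVn lef_pV2 ?posrE ?expR_gt0 ?exprn_gt0 //; last first.
  by rewrite ltr_pwDl // invr_ge0; have := N1; lra.
have -> : expR 1 = expR ((N - 1)^-1) ^+ n.-1.
  by rewrite -expRM_natl nE mulfV // gt_eqF //; have := N1; lra.
have i0 : 0 <= (N - 1)^-1 by rewrite invr_ge0; have := N1; lra.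
by apply: lerXn2r; rewrite ?nnegrE ?expR_ge0 ?expR_ge1Dx //; lra.
Qed.

(** With [miss_ge_expR1], the mean growth factor [2 - q] of a round is [2 - 1/e] up to an error
    [k / N]. *)
Lemma miss_le_expR1 : q <= (expR 1)^-1 + k / N.
Proof.
apply: le_trans miss_le_expR _; rewrite -expRN.
have -> : - x = - 1 + k / N by rewrite /x; field; rewrite gt_eqF.
set y := k / N.
set z := - 1 + y.
have z0 : expR z <= 1.
  rewrite -expR0 ler_expR /z /y; have := x_bounds; rewrite /x.
  have -> : (N - k) / N = 1 - k / N by field; rewrite gt_eqF.
  lra.
have -> : expR (- 1) = expR z * expR (- y) by rewrite -expRD; congr expR; rewrite /z; ring.
have y0 : 0 <= y by rewrite divr_ge0.
have : 0 <= expR z * (expR (- y) - (1 - y)).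
  by rewrite mulr_ge0 ?expR_ge0 // subr_ge0; exact: expR_ge1Dx.
have : 0 <= y * (1 - expR z) by rewrite mulr_ge0 // subr_ge0.
by lra.
Qed.

Definition nmissed (r : round n) : R := #|missed S r.1|%:R.

(** Drift estimates bound a function of the next state by a quadratic in the missed count; the two
    moments then bound its mean. *)
Lemma le_rmean_missed F a b c : 0 <= c ->
  (forall r, F r <= a + b * nmissed r + c * (nmissed r - k * q) ^+ 2) ->
  rmean F <= a + b * (k * q) + c * (k * q * (1 - q)).
Proof.
move=> c0 /le_rmean/le_trans; apply; rewrite !rmeanD !rmeanZ rmean_cst.
by rewrite (rmean_missed S) lerD2l ler_wpM2l // rmean_missed_var.
Qed.

Lemma ge_rmean_missed F a b c : 0 <= c ->
  (forall r, a + b * nmissed r - c * (nmissed r - k * q) ^+ 2 <= F r) ->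
  a + b * (k * q) - c * (k * q * (1 - q)) <= rmean F.
Proof.
move=> c0 H; have := @le_rmean_missed (fun r => -1 * F r) (- a) (- b) c c0.
rewrite rmeanZ => /(_ _)/wrap[r|]; first by have := H r; lra.
lra.
Qed.

Lemma stepE r : #|step S r|%:R = 2 * k - nmissed r.
Proof.
have := card_step S r => /(congr1 (fun m => m%:R : R)); rewrite !natrD /nmissed /k.
by lra.
Qed.

Lemma nmissed_le r : 0 <= nmissed r <= k.
Proof.
rewrite ler0n ler_nat subset_leq_card //.
by apply/fintype.subsetP => v; rewrite inE => /andP[].
Qed.

Lemma k_bounds : 1 <= k /\ k <= N - 1.
Proof.
case/andP: S0 => k0 kn; rewrite ler1n; split => //.
by rewrite lerBrDr natr1 ler_nat.
Qed.

End MissBounds.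

(** * Upper bound *)

Section Growth.
Context {R : realType}.

Definition growth : R := 2 - (expR 1)^-1.

Lemma expR1V_bounds : 0 < (expR 1 : R)^-1 <= 1 / 2.
Proof.
rewrite invr_gt0 expR_gt0 /= mul1r lef_pV2 ?posrE ?expR_gt0 //.
by have := expR_ge1Dx (1 : R); lra.
Qed.

Lemma growth_bounds : 3 / 2 <= growth < 2.
Proof. by have := expR1V_bounds; rewrite /growth; lra. Qed.

Lemma ln_growth_gt0 : 0 < ln growth.
Proof. by apply: ln_gt0; have := growth_bounds; lra. Qed.

End Growth.
Arguments growth : clear implicits.

Section UpperPotential.
Context {R : realType}.
Variable n : nat.
Let N : R := n%:R.
Let lam : R := ln (growth R).

(* Up to fluctuations a round multiplies [j] by [growth], so the first term
   falls by 1. Fluctuations of [ln j] cost [O (1 / j)] and the uninformed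
   nodes already lost to the informed ones cost [O (j / n)]; the monotone terms
   [1 / j] and [- j / n] pay for both. *)
Definition up_early (j : nat) : R :=
  (ln N - ln j%:R) / lam + 1024 / lam * (j%:R^-1 - j%:R / N + 1).

(* With [u] uninformed nodes the next round leaves at most [2 u ^ 2 / n] of them
   on average, while [D = 16 u + 8] satisfies [16 (2 u ^ 2 / n) + 8 <= D ^ 2 / (4 n)]
   as soon as [4 u ^ 2 >= n]: on average [ln (n / D)] doubles. The summand 8
   keeps [lnr] finite at [u = 0], and the cap [n / 128] below keeps it above 1. *)
Definition lnr (u : R) : R := ln (N / (16 * u + 8)).

(** Binary logarithm of a ratio of [lnr] values: the number of doublings of [lnr] still to come. *)
Definition up_late (j : nat) : R :=
  (ln (lnr 0) - ln (lnr (Order.min (N - j%:R) (N / 128)))) / ln 2.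

(* Once [4 u ^ 2 < n], a round succeeds with probability at least [1 / 2]. *)
Definition up_last (j : nat) : R := 2 * (j < n)%N%:R.

Definition up (j : nat) : R := up_early j + (up_late j + up_last j).

Hypothesis n64 : (64 <= n)%N.
Let N64 : 64 <= N. Proof. by rewrite (ler_nat _ 64). Qed.
Let lam0 : 0 < lam. Proof. exact: ln_growth_gt0. Qed.
Let ln20 : 0 < ln 2 :> R. Proof. by have := @ln2_ge R; lra. Qed.
Let c0 : 0 < 1024 / lam. Proof. by apply: (divr_gt0 _ lam0); lra. Qed.

Lemma up_early_anti i j : (0 < i)%N -> (i <= j)%N -> up_early j <= up_early i.
Proof.
move=> i0 ij; have j0 : (0 < j)%N by apply: leq_trans ij.
have i0R : 0 < i%:R :> R by rewrite ltr0n.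
have j0R : 0 < j%:R :> R by rewrite ltr0n.
have ijR : i%:R <= j%:R :> R by rewrite ler_nat.
apply: lerD.
  by rewrite ler_wpM2r ?invr_ge0 ?(ltW lam0) // lerD2l lerN2 ler_ln ?posrE.
apply: (ler_wpM2l (ltW c0)); rewrite lerD2r; apply: lerB.
  by rewrite lef_pV2 ?posrE.
by rewrite ler_wpM2r // invr_ge0; have := N64; lra.
Qed.

Lemma up_early_ge0 j : (0 < j <= n)%N -> 0 <= up_early j.
Proof.
case/andP => j0 jn; apply: le_trans (up_early_anti j0 jn).
rewrite /up_early subrr mul0r add0r mulfV ?subrK; last by have := N64; lra.
apply: (mulr_ge0 (ltW c0)); rewrite invr_ge0; have := N64; lra.
Qed.

Lemma lnr_anti u v : 0 <= u -> u <= v -> lnr v <= lnr u.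
Proof.
move=> u0 uv; have := N64 => N64'.
rewrite ler_ln ?posrE ?divr_gt0; [|lra..].
by rewrite ler_wpM2l ?lef_pV2 ?posrE; lra.
Qed.

(** At the cap, [16 * u + 8] is [N / 8 + 8], at most [N / 4] once [64 <= N], and [ln 4] is at least
    1. *)
Lemma lnr_cap_ge1 u : 0 <= u -> u <= N / 128 -> 1 <= lnr u.
Proof.
move=> u0 uN; have := N64 => N64'; apply: le_trans (lnr_anti u0 uN).
by apply: le1_ln; rewrite ler_pdivlMr; lra.
Qed.

Let cap u : 0 <= u -> 0 <= Order.min u (N / 128) <= N / 128.
Proof. by move=> u0; have := N64; rewrite le_min ge_min lexx orbT u0 /=; lra. Qed.

Lemma up_late_anti i j : (i <= j <= n)%N -> up_late j <= up_late i.
Proof.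
case/andP => ij jn.
have jN : 0 <= N - j%:R by rewrite subr_ge0 ler_nat.
have ijN : N - j%:R <= N - i%:R by rewrite lerD2l lerN2 ler_nat.
rewrite /up_late ler_wpM2r ?invr_ge0 ?(ltW ln20) // lerD2l lerN2.
have /andP[mj0 mj] := cap jN; have /andP[mi0 mi] := cap (le_trans jN ijN).
rewrite ler_ln ?posrE; last 2 first.
- by apply: lt_le_trans (lnr_cap_ge1 mi0 mi).
- by apply: lt_le_trans (lnr_cap_ge1 mj0 mj).
apply: lnr_anti => //; rewrite le_min ge_min ijN /= ge_min lexx orbT //.
Qed.

Lemma up_late_ge0 j : (j <= n)%N -> 0 <= up_late j.
Proof.
move=> jn; have := @up_late_anti j n; rewrite jn leqnn => /(_ isT); apply: le_trans.
rewrite /up_late subrr (_ : Order.min _ _ = 0) ?subrr ?mul0r //.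
by apply/min_idPl; have := N64; lra.
Qed.

Lemma up_last_anti i j : (i <= j)%N -> up_last j <= up_last i.
Proof.
move=> ij; rewrite ler_pM2l ?ler_nat; last lra.
by case: (ltnP j n) => // jn; rewrite (leq_ltn_trans ij jn).
Qed.

Lemma up_ge0 j : (0 < j <= n)%N -> 0 <= up j.
Proof.
move=> jn; rewrite addr_ge0 ?up_early_ge0 // addr_ge0 //.
  by apply: up_late_ge0; case/andP: jn.
by rewrite mulr_ge0.
Qed.

(** The correction terms of [up_early] add at most [2 * 1024 / lam] and [up_last] adds 2; in
    [up_late], [lnr 0] is at most [ln N]. *)
Lemma up1_le : 1 <= ln N ->
  up 1 <= ln N / lam + ln (ln N) / ln 2 + (2048 / lam + 2).
Proof.
move=> lnN1.
have e : up_early 1 <= ln N / lam + 2048 / lam.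
  rewrite /up_early ln1 subr0 invr1 lerD2l.
  have -> : 2048 / lam = 1024 / lam * 2 by ring.
  apply: (ler_wpM2l (ltW c0)).
  have : 0 <= 1 / N by rewrite divr_ge0; have := N64; lra.
  by lra.
have l : up_late 1 <= ln (ln N) / ln 2.
  rewrite /up_late ler_wpM2r ?invr_ge0 ?(ltW ln20) //.
  have /andP[m0 m1] : 0 <= Order.min (N - 1) (N / 128) <= N / 128.
    by apply: cap; have := N64; lra.
  have := ln_ge0 (lnr_cap_ge1 m0 m1).
  suff : ln (lnr 0) <= ln (ln N) by lra.
  have N64' := N64; rewrite ler_ln ?posrE.
  - rewrite ler_ln ?posrE ?divr_gt0; [|lra..].
    by rewrite ler_pdivrMr; lra.
  - by apply: (@lt_le_trans _ _ 1) => //; apply: lnr_cap_ge1; lra.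
  - lra.
have : up_last 1 <= 2.
  by rewrite /up_last; case: ltnP => _ /=; lra.
rewrite /up; lra.
Qed.

End UpperPotential.

Arguments up_early : clear implicits.
Arguments up_late : clear implicits.
Arguments up_last : clear implicits.
Arguments up : clear implicits.

(** * Drift of the upper potentials *)

Section UpperDrift.
Context {R : realType}.
Variables (n : nat) (S : {set 'I_n}).
Hypotheses (n64 : (64 <= n)%N) (S0 : (0 < #|S| < n)%N).
Let N : R := n%:R.
Let k : R := #|S|%:R.
Let q : R := miss S.
Let x : R := (N - k) / N.
Let lam : R := ln (growth R).
Let n1 : (1 < n)%N. Proof. exact: leq_trans n64. Qed.
Let N64 : 64 <= N. Proof. by rewrite (ler_nat _ 64). Qed.
Let lam0 : 0 < lam. Proof. exact: ln_growth_gt0. Qed.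
Let ln20 : 0 < ln 2 :> R. Proof. by have := @ln2_ge R; lra. Qed.
Let c0 : 0 < 1024 / lam. Proof. by apply: (divr_gt0 _ lam0); lra. Qed.
Let k1 : 1 <= k. Proof. by have [] := @k_bounds R _ _ S0. Qed.
Let kN : k <= N - 1. Proof. by have [] := @k_bounds R _ _ S0. Qed.
Let stepS r : (#|S| <= #|step S r| <= n)%N.
Proof.
have := max_card (mem (step S r)); rewrite card_ord => ->.
rewrite andbT subset_leq_card //.
exact: finset.subsetUl.
Qed.

(** Expands [ln (1 + z)] at [1 - 1/e], where [z] is the fraction of informed nodes that are hit. The
    bias [q - iota] costs at most [3 * (k / N)], the variance at most [k^-1]. *)
Lemma rmean_ln_step_ge :
  ln k + lam - 3 * (k / N) - k^-1 <= rmean (fun r => ln #|step S r|%:R).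
Proof.
have k0 : 0 < k by apply: lt_le_trans k1.
set iota := (expR 1)^-1 : R.
have ib : 0 < iota <= 1 / 2 by exact: expR1V_bounds.
have gE : growth R = 1 + (1 - iota) by rewrite /growth /iota; ring.
have g0 := @growth_bounds R.
have q01 : 0 <= q <= 1 by exact: miss_bounds.
have d0 : iota <= q by exact: miss_ge_expR1.
have d1 : q <= iota + k / N by exact: miss_le_expR1.
(* The coefficient 2, here and in [2 / k ^+ 2], comes from
   [(w + y) ^+ 2 <= 2 * w ^+ 2 + 2 * y ^+ 2], separating fluctuation from bias. *)
pose a := ln k + lam + iota / growth R - 2 * (q - iota) ^+ 2.
pose b := - (k * growth R)^-1.
apply: le_trans (@ge_rmean_missed R n S n1 _ a b (2 / k ^+ 2) _ _); last 2 first.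
- by rewrite divr_ge0 // exprn_ge0 // ltW.
- move=> r; rewrite stepE; fold k.
  have /andP[M0 Mk] := @nmissed_le R _ S r; fold k in Mk; set M := @nmissed R _ S r in M0 Mk *.
  pose z := (k - M) / k.
  have z0 : 0 <= z by rewrite divr_ge0 ?subr_ge0 // ltW.
  have -> : 2 * k - M = k * (1 + z) by rewrite /z; field; rewrite gt_eqF.
  rewrite lnM ?posrE //; last lra.
  have m0 : 0 <= 1 - iota by lra.
  have := ln_ge_quad z0 m0; rewrite -gE -/lam.
  pose w := (M - k * q) / k.
  have -> : z - (1 - iota) = - w - (q - iota) by rewrite /w /z; field; rewrite gt_eqF.
  have -> : 2 / k ^+ 2 * (M - k * q) ^+ 2 = 2 * w ^+ 2 by rewrite /w; field; rewrite gt_eqF.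
  have -> : a + b * M = ln k + lam + (- w - (q - iota)) / growth R - 2 * (q - iota) ^+ 2.
    by rewrite /a /b /w; field; rewrite !gt_eqF //; lra.
  have : 0 <= (w - (q - iota)) ^+ 2 by rewrite sqr_ge0.
  by lra.
have -> : a + b * (k * q) - 2 / k ^+ 2 * (k * q * (1 - q)) =
   ln k + lam - (q - iota) / growth R - 2 * (q - iota) ^+ 2 - 2 * (q * (1 - q)) * k^-1.
  by rewrite /a /b; field; rewrite !gt_eqF //; lra.
have : 2 * (q * (1 - q)) * k^-1 <= k^-1.
  by rewrite ler_piMl ?invr_ge0 ?(ltW k0) //; have : 0 <= (q - 1 / 2) ^+ 2; [rewrite sqr_ge0|lra].
have : (q - iota) ^+ 2 <= q - iota by rewrite expr2 ler_piMl; lra.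
have : (q - iota) / growth R <= q - iota.
  by rewrite ler_pdivrMr ?ler_peMr; lra.
by lra.
Qed.

(** The inverse is convex, and [(k + M) / (2 * k ^+ 2)] is its chord between the extreme sizes [k]
    and [2 * k]. *)
Lemma rmean_inv_step_le :
  rmean (fun r => #|step S r|%:R^-1) <= k^-1 - (1 - q) / (2 * k).
Proof.
have k0 : 0 < k by apply: lt_le_trans k1.
have := @le_rmean_missed R n S n1 (fun r => #|step S r|%:R^-1)
  (1 / (2 * k)) ((2 * k ^+ 2)^-1) 0 (lexx 0).
move=> /(_ _)/wrap[r|]; last first.
  move/le_trans; apply; rewrite mul0r addr0 le_eqVlt; apply/orP; left; apply/eqP.
  by rewrite -/k -/q; field; rewrite gt_eqF.
rewrite mul0r addr0 stepE; fold k.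
have /andP[M0 Mk] := @nmissed_le R _ S r; fold k in Mk; set M := @nmissed R _ S r in M0 Mk *.
have -> : 1 / (2 * k) + (2 * k ^+ 2)^-1 * M = (k + M) / (2 * k ^+ 2).
  by field; rewrite gt_eqF.
rewrite ler_pdivlMr ?mulr_gt0 ?exprn_gt0 // mulrC ler_pdivrMr; last lra.
have : 0 <= M * (k - M) by rewrite mulr_ge0 // subr_ge0.
by lra.
Qed.

Lemma rmean_step : rmean (fun r => #|step S r|%:R) = 2 * k - k * q.
Proof.
under [X in rmean X]funext do rewrite stepE -mulN1r.
by rewrite rmeanD rmean_cst rmeanZ (rmean_missed S) mulN1r.
Qed.

Lemma up_early_drift : N < 128 * (N - k) ->
  rmean (fun r => up_early R n #|step S r|) <= up_early R n #|S| - 1.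
Proof.
move=> early; have k0 : 0 < k by apply: lt_le_trans k1.
have -> : (fun r => up_early R n #|step S r|) = (fun r =>
   (- lam^-1) * ln #|step S r|%:R + ((1024 / lam) * (#|step S r|%:R^-1) +
   (- (1024 / lam / N) * #|step S r|%:R + (ln N / lam + 1024 / lam)))).
  by apply/funext => r; rewrite /up_early; ring.
rewrite !rmeanD !rmeanZ rmean_cst rmean_step.
have := rmean_inv_step_le; have := rmean_ln_step_ge.
set A := rmean _; set B := rmean _ => hA hB.
rewrite /up_early -/N -/k -/lam.
(* Origin of 1024: it makes [1024 * (1 - q)] at least 4, so the correction terms outweigh the losses
   [k^-1] and [3 * (k / N)]. *)
have hit : 1 / 256 <= 1 - q.
  apply: le_trans (@hit_ge R _ _ n1 S0); rewrite -/N -/k -/x.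
  have := @x_bounds R _ _ n1 S0; rewrite -/N -/k -/x => x01.
  have x128 : 1 / 128 <= x by rewrite /x ler_pdivlMr; lra.
  by rewrite ler_pdivlMr; lra.
have /ler_wpM2l/(_ _ _ hA) h1 : 0 <= lam^-1 by rewrite invr_ge0 ltW.
have /ler_wpM2l/(_ _ _ hB) h2 : 0 <= 1024 / lam by rewrite ltW.
have h3 : lam^-1 * k^-1 * 4 <= 1024 / lam * ((1 - q) / (2 * k)) * 2.
  have -> : 1024 / lam * ((1 - q) / (2 * k)) * 2 = lam^-1 * k^-1 * (1024 * (1 - q)).
    by field; rewrite !gt_eqF.
  rewrite ler_wpM2l ?mulr_ge0 ?invr_ge0 ?(ltW k0) ?(ltW lam0) //; lra.
have h4 : lam^-1 * (k / N) * 4 <= 1024 / lam / N * (k * (1 - q)).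
  have -> : 1024 / lam / N * (k * (1 - q)) = lam^-1 * (k / N) * (1024 * (1 - q)).
    by field; rewrite !gt_eqF //; lra.
  rewrite ler_wpM2l ?mulr_ge0 ?invr_ge0 ?(ltW k0) ?(ltW lam0) //; lra.
have e1 : lam^-1 * (ln k + lam - 3 * (k / N) - k^-1) =
  lam^-1 * ln k + 1 - 3 * (lam^-1 * (k / N)) - lam^-1 * k^-1.
  by field; rewrite !gt_eqF //; lra.
have p1 : 0 <= lam^-1 * k^-1 by rewrite mulr_ge0 ?invr_ge0 ?(ltW k0) ?(ltW lam0).
have p2 : 0 <= lam^-1 * (k / N).
  by rewrite mulr_ge0 ?divr_ge0 ?invr_ge0 ?(ltW k0) ?(ltW lam0) //; lra.
rewrite e1 in h1; lra.
Qed.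

(** Hits have probability at least [x / (1 + x)], and [x - (1 - x) * (x / (1 + x))] equals
    [2 * x ^+ 2 / (1 + x)]. *)
Lemma mean_uninformed : N - (2 * k - k * q) <= 2 * (N - k) ^+ 2 / N.
Proof.
have k0 : 0 < k by apply: lt_le_trans k1.
have := @hit_ge R _ _ n1 S0; rewrite -/N -/k -/x -/q.
have := @x_bounds R _ _ n1 S0; rewrite -/N -/k -/x => x01 h.
have N0 : 0 < N by have := N64; lra.
have kE : k = N * (1 - x) by rewrite /x; field; rewrite gt_eqF.
have -> : 2 * (N - k) ^+ 2 / N = N * (2 * x ^+ 2) by rewrite /x; field; rewrite gt_eqF.
have -> : N - (2 * k - k * q) = N * (x - (1 - x) * (1 - q)) by rewrite kE; ring.
rewrite ler_wpM2l ?(ltW N0) //.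
have : (1 - x) * (x / (1 + x)) <= (1 - x) * (1 - q) by rewrite ler_wpM2l; lra.
suff : x - (1 - x) * (x / (1 + x)) <= 2 * x ^+ 2 by lra.
have -> : x - (1 - x) * (x / (1 + x)) = 2 * x ^+ 2 / (1 + x) by field; lra.
rewrite ler_pdivrMr; last lra.
have : 0 <= x ^+ 2 * x by apply: mulr_ge0; [exact: sqr_ge0|lra].
by lra.
Qed.

(** Markov's inequality: the mean number of uninformed nodes left is at most [1 / 2], and the factor
    2 turns this into a drop of 1. *)
Lemma up_last_drift : 4 * (N - k) ^+ 2 < N ->
  rmean (fun r => up_last R n #|step S r|) <= up_last R n #|S| - 1.
Proof.
move=> late; have -> : up_last R n #|S| - 1 = 1.
  by case/andP: S0 => _ Sn; rewrite /up_last Sn /=; lra.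
apply: (@le_trans _ _ (rmean (fun r => 2 * N + (- 2) * #|step S r|%:R))).
  apply: le_rmean => r; rewrite /up_last; have /andP[_] := stepS r.
  case: ltnP => [sn _|ns sn].
    have : #|step S r|%:R + 1 <= N by rewrite natr1 ler_nat.
    by rewrite -/N /=; lra.
  have -> : #|step S r| = n by apply/eqP; rewrite eqn_leq sn.
  by rewrite -/N /=; lra.
rewrite rmeanD rmean_cst rmeanZ rmean_step.
have := mean_uninformed.
have : 2 * (N - k) ^+ 2 / N <= 1 / 2 by rewrite ler_pdivrMr; have := N64; lra.
by lra.
Qed.

Lemma up_late_drift : N <= 4 * (N - k) ^+ 2 -> 128 * (N - k) <= N ->
  rmean (fun r => up_late R n #|step S r|) <= up_late R n #|S| - 1.
Proof.
move=> mid late; have N0 : 0 < N by have := N64; lra.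
set u := N - k in mid late *; have uE : u = N - k by [].
have u1 : 1 <= u by rewrite /u; have := kN; lra.
pose D := 16 * u + 8.
have D0 : 0 < D by rewrite /D; lra.
pose L := lnr n u.
have L1 : 1 <= L by apply: lnr_cap_ge1 => //; rewrite -/N; lra.
have LE : L = ln (N / D) by [].
(* [Ds] is the next value of [D] for which [lnr] exactly doubles; [D' / Ds] below measures the
   deviation from it. *)
pose Ds := D ^+ 2 / N.
have Ds0 : 0 < Ds by rewrite divr_gt0 ?exprn_gt0.
have lnDs : ln (N / Ds) = 2 * L.
  have -> : N / Ds = (N / D) ^+ 2 by rewrite /Ds; field; rewrite !gt_eqF.
  by rewrite lnXn ?divr_gt0 // mulr_natl.
have minE (v : R) : v <= u -> Order.min v (N / 128) = v.
  by move=> vu; apply/min_idPl; lra.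
pose c := ((2 * L) * ln 2)^-1.
have cgt0 : 0 < c by rewrite invr_gt0 !mulr_gt0 //; lra.
pose K := (ln (lnr n 0) - ln (2 * L)) / ln 2.
have KE : up_late R n #|S| - 1 = K.
  rewrite /up_late -/N -/k -/u minE // -/L /K lnM ?posrE; try lra.
  by field; rewrite gt_eqF.
rewrite KE.
(* [lnln_le_linear] gives a bound affine in the new size, so only the mean of [D' / Ds] matters; it
   is at most [1 / 4]. *)
apply: (@le_trans _ _ (rmean (fun r =>
   (K + c * (2 * ((16 * N + 8) / Ds) - 1 / 2)) + (- (c * 2 * 16 / Ds)) * #|step S r|%:R))).
  apply: le_rmean => r; have /andP[Sr rn] := stepS r.
  set s : R := #|step S r|%:R.
  have ks : k <= s by rewrite ler_nat.
  have sN : s <= N by rewrite ler_nat.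
  rewrite /up_late -/N -/s minE; last by rewrite /u; lra.
  pose D' := 16 * (N - s) + 8.
  have D'0 : 0 < D' by rewrite /D'; lra.
  have t0 : 0 < D' / Ds by rewrite divr_gt0.
  have L'1 : 1 <= lnr n (N - s) by apply: lnr_cap_ge1 => //; rewrite -/N; lra.
  have L'E : lnr n (N - s) = 2 * L - ln (D' / Ds).
    have ND0 : 0 < N / Ds by rewrite divr_gt0.
    rewrite -lnDs -(ln_div ND0 t0) /lnr -/N -/D'; congr ln.
    have D'n : 16 * (N - s) + 8 != 0 by rewrite gt_eqF.
    by field; rewrite D'n gt_eqF.
  have L21 : 1 <= 2 * L by lra.
  have := lnln_le_linear t0 L21; rewrite -L'E => /(_ L'1) H.
  have -> : K + c * (2 * ((16 * N + 8) / Ds) - 1 / 2) + - (c * 2 * 16 / Ds) * s =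
     (ln (lnr n 0) + (- ln (2 * L) + (2 * (D' / Ds) - 1 / 2) / (2 * L))) / ln 2.
    by rewrite /K /c /D'; field; rewrite !gt_eqF //; lra.
  by rewrite ler_wpM2r ?invr_ge0 ?(ltW ln20) // lerD2l.
rewrite rmeanD rmean_cst rmeanZ rmean_step.
have := mean_uninformed; rewrite -/u; set v := 2 * k - k * q => hv.
have -> : K + c * (2 * ((16 * N + 8) / Ds) - 1 / 2) + - (c * 2 * 16 / Ds) * v =
  K + c * (2 * ((16 * (N - v) + 8) / Ds) - 1 / 2).
  by field; rewrite gt_eqF.
rewrite gerDl pmulr_rle0 //.
suff : (16 * (N - v) + 8) / Ds <= 1 / 4 by lra.
rewrite ler_pdivrMr // /Ds.
apply: (@le_trans _ _ (16 * (2 * u ^+ 2 / N) + 8)); first lra.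
have -> : 16 * (2 * u ^+ 2 / N) + 8 = (32 * u ^+ 2 + 8 * N) / N by field; rewrite gt_eqF.
have -> : 1 / 4 * (D ^+ 2 / N) = (D ^+ 2 / 4) / N by field; rewrite gt_eqF.
rewrite ler_wpM2r ?invr_ge0 ?(ltW N0) // /D; nra.
Qed.

(** None of the three potentials ever increases, so it is enough that one of them drops by 1 in the
    current phase. *)
Lemma up_drift : rmean (fun r => up R n #|step S r|) <= up R n #|S| - 1.
Proof.
have e : rmean (fun r => up_early R n #|step S r|) <= up_early R n #|S| :> R.
  rewrite -[leRHS](rmean_cst n); apply: le_rmean => r; case/andP: (stepS r) => ? _.
  by apply: up_early_anti => //; case/andP: S0.
have l : rmean (fun r => up_late R n #|step S r|) <= up_late R n #|S|.
  by rewrite -[leRHS](rmean_cst n); apply: le_rmean => r; apply: up_late_anti.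
have f : rmean (fun r => up_last R n #|step S r|) <= up_last R n #|S|.
  rewrite -[leRHS](rmean_cst n); apply: le_rmean => r; apply: up_last_anti.
  by case/andP: (stepS r).
rewrite /up 2!rmeanD.
have [/up_early_drift|late] := ltP N (128 * (N - k)); first lra.
have [/up_last_drift|mid] := ltP (4 * (N - k) ^+ 2) N; first lra.
by have := up_late_drift mid late; lra.
Qed.

End UpperDrift.

(** * Lower bound *)

Section LowerPotential.
Context {R : realType}.
Variable n : nat.
Let N : R := n%:R.
Let lam : R := ln (growth R).

(** The 2 inside makes it grow by exactly 1 when [y] becomes [y ^+ 2 / 2], half the square. *)
Definition lnln (y : R) : R := ln (ln (2 / y)) / ln 2.

(* [n ^ (- 1 / 4)]: while the uninformed fraction exceeds it, Chebyshev's
   inequality keeps the next fraction above half the square of the current one. *)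
Definition cutoff : R := expR (- (ln N / 4)).

Definition clamp (y : R) : R := Order.max cutoff (Order.min y (1 / 2)).

(* [low_early] vanishes from [n / 4] informed nodes on, and [low_late] is constant
   up to [n / 2] of them; as a round at most doubles their number, at any
   time only one of the two moves. *)
Definition low_early (j : nat) : R := Order.max 0 ((ln N - ln 4 - ln j%:R) / lam).

Definition low_late (j : nat) : R := lnln cutoff - lnln (clamp ((N - j%:R) / N)).

Definition low (j : nat) : R := low_early j + low_late j.

Definition low_range : R := lnln cutoff - lnln (1 / 2).

Hypothesis n16 : (16 <= n)%N.
Let N16 : 16 <= N. Proof. by rewrite (ler_nat _ 16). Qed.
Let lam0 : 0 < lam. Proof. exact: ln_growth_gt0. Qed.
Let ln20 : 0 < ln 2 :> R. Proof. by have := @ln2_ge R; lra. Qed.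

Lemma lnN_ge : 4 * ln 2 <= ln N.
Proof.
have -> : 4 * ln 2 = ln (2 ^+ 4) :> R by rewrite lnXn ?mulr_natl.
by rewrite ler_ln ?posrE; have := N16; lra.
Qed.

Lemma cutoff_bounds : 0 < cutoff <= 1 / 2.
Proof.
rewrite expR_gt0 /= -[leRHS]lnK ?posrE; last lra.
by rewrite ler_expR mul1r lnV ?posrE; have := lnN_ge; lra.
Qed.

Lemma clamp_bounds y : cutoff <= clamp y <= 1 / 2.
Proof.
have := cutoff_bounds => /andP[_ c2].
by rewrite /clamp le_max lexx ge_max c2 ge_min lexx orbT.
Qed.

Lemma lnln_anti y z : 0 < y -> y <= z -> z <= 1 -> lnln z <= lnln y.
Proof.
move=> y0 yz z1; rewrite /lnln ler_wpM2r ?invr_ge0 ?(ltW ln20) //.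
have h w : 0 < w -> w <= 1 -> 0 < ln (2 / w).
  by move=> w0 w1; rewrite ln_gt0 // ltr_pdivlMr; lra.
rewrite ler_ln ?posrE ?h //; try lra.
rewrite ler_ln ?posrE ?divr_gt0 //; try lra.
by rewrite ler_wpM2l ?lef_pV2 ?posrE //; lra.
Qed.

Lemma lnln_sqr y : 0 < y -> y <= 1 -> lnln (y ^+ 2 / 2) = 1 + lnln y.
Proof.
move=> y0 y1; rewrite /lnln.
have -> : 2 / (y ^+ 2 / 2) = (2 / y) ^+ 2 by field; rewrite gt_eqF.
have h : 0 < ln (2 / y) by rewrite ln_gt0 // ltr_pdivlMr; lra.
rewrite lnXn ?divr_gt0 // -(mulr_natl (ln (2 / y))) lnM ?posrE // mulrDl mulfV // gt_eqF //.
Qed.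

Lemma low_late_bounds j : 0 <= low_late j <= low_range.
Proof.
have /andP[c0 c2] := cutoff_bounds.
have /andP[l u] := clamp_bounds ((N - j%:R) / N).
rewrite /low_late /low_range subr_ge0 lerD2l lerN2 !lnln_anti //; lra.
Qed.

Lemma low_n : low n = 0.
Proof.
rewrite /low /low_early /low_late.
have -> : Order.max 0 ((ln N - ln 4 - ln n%:R) / lam) = 0.
  apply/max_idPl; rewrite pmulr_lle0 ?invr_gt0 //.
  by have := @ln4_ge1 R; rewrite -/N; lra.
have /andP[c0 c2] := cutoff_bounds.
rewrite -/N subrr mul0r add0r /clamp.
have -> : Order.min 0 (1 / 2) = 0 :> R by apply/min_idPl; lra.
by rewrite (max_idPl _) ?subrr // ltW.
Qed.

Lemma low_le j : (0 < j)%N -> low j <= ln N / lam + low_range.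
Proof.
move=> j0; apply: lerD; last by case/andP: (low_late_bounds j).
have j1 : 0 <= ln j%:R :> R by rewrite ln_ge0 // ler1n.
have := @ln4_ge1 R; have := lnN_ge; have := @ln2_ge R => h1 h2 h3.
rewrite /low_early ge_max divr_ge0 ?(ltW lam0) //=; last lra.
by rewrite ler_wpM2r ?invr_ge0 ?(ltW lam0) //; lra.
Qed.

Lemma lnln_cutoff : lnln cutoff = ln (ln 2 + ln N / 4) / ln 2.
Proof.
by rewrite /lnln /cutoff expRN invrK lnM ?posrE ?expR_gt0 // expRK.
Qed.

(** A crude bound by [ln y < y] is enough, as the range is later divided by [n ^ (1 / 4)]. *)
Lemma low_range_bounds : 0 <= low_range <= 1 + ln N / 2.
Proof.
have /andP[c0 c2] := cutoff_bounds.
apply/andP; split; first by rewrite subr_ge0 lnln_anti //; lra.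
have l4 : 0 <= lnln (1 / 2).
  rewrite /lnln (_ : 2 / (1 / 2) = 4); last by field.
  by rewrite divr_ge0 ?(ltW ln20) // ln_ge0 // ln4_ge1.
rewrite /low_range lnln_cutoff.
have := lnN_ge => h; have h2 := @ln2_ge R.
have : ln (ln 2 + ln N / 4) / ln 2 <= 1 + ln N / 2.
  rewrite ler_pdivrMr //; apply: le_trans (ltW (ln_sublinear _)) _; first lra.
  have : 0 <= ln N * (ln 2 - 1 / 2) by rewrite mulr_ge0; lra.
  by lra.
by lra.
Qed.

(** Stopping at the cutoff costs only 2: [lnln] of it is at least the binary logarithm of
    [ln N / 4]. *)
Lemma low1_ge : ln N / lam + ln (ln N) / ln 2
  - (ln 4 / lam + 2 + lnln (1 / 2)) <= low 1.
Proof.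
have /andP[c0 c2] := cutoff_bounds; have N16' := N16.
have lnN0 : 0 < ln N by have := lnN_ge; have := @ln2_ge R; lra.
have : (ln N - ln 4) / lam <= low_early 1.
  by rewrite /low_early ln1 subr0 le_max lexx orbT.
have : lnln cutoff - lnln (1 / 2) <= low_late 1.
  have c : clamp ((N - 1) / N) = 1 / 2.
    rewrite /clamp (_ : Order.min _ _ = 1 / 2); first by apply/max_idPr.
    by apply/min_idPr; rewrite ler_pdivlMr; lra.
  by rewrite /low_late c.
have : ln (ln N) / ln 2 - 2 <= lnln cutoff.
  rewrite lnln_cutoff -{2}(mulfK (lt0r_neq0 ln20) 2) -mulrBl ler_wpM2r ?invr_ge0 ?(ltW ln20) //.
  rewrite -ln4E -ln_div ?posrE //.
  by rewrite ler_ln ?posrE ?divr_gt0 //; have := @ln2_ge R; lra.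
have -> : (ln N - ln 4) / lam = ln N / lam - ln 4 / lam by rewrite mulrBl.
by rewrite /low; lra.
Qed.

End LowerPotential.
Arguments low_early : clear implicits.
Arguments low_late : clear implicits.
Arguments low : clear implicits.
Arguments low_range : clear implicits.
Arguments cutoff : clear implicits.

(** * Drift of the lower potential *)

Section LowerDrift.
Context {R : realType}.
Variables (n : nat) (S : {set 'I_n}).
Hypotheses (n16 : (16 <= n)%N) (S0 : (0 < #|S| < n)%N).
Let N : R := n%:R.
Let k : R := #|S|%:R.
Let q : R := miss S.
Let x : R := (N - k) / N.
Let lam : R := ln (growth R).
Let n1 : (1 < n)%N. Proof. exact: leq_trans n16. Qed.
Let N16 : 16 <= N. Proof. by rewrite (ler_nat _ 16). Qed.
Let lam0 : 0 < lam. Proof. exact: ln_growth_gt0. Qed.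
Let k1 : 1 <= k. Proof. by have [] := @k_bounds R _ _ S0. Qed.
Let kN : k <= N - 1. Proof. by have [] := @k_bounds R _ _ S0. Qed.

Lemma low_early_drift : 4 * k < N ->
  low R n #|S| - 1 <= rmean (fun r => low R n #|step S r|).
Proof.
move=> early; have k0 : 0 < k by apply: lt_le_trans k1.
have N0 : 0 < N by lra.
(* A round at most doubles [k < N / 4], so the uninformed fraction stays at least [1 / 2], where the
   late potential is constant. *)
have lateE (s : R) : s <= 2 * k -> clamp n ((N - s) / N) = 1 / 2.
  move=> s2; rewrite /clamp (_ : Order.min _ _ = 1 / 2).
    by apply/max_idPr; case/andP: (@cutoff_bounds R n n16).
  by apply/min_idPr; rewrite ler_pdivlMr; lra.
have earlyE : low_early R n #|S| = (ln N - ln 4 - ln k) / lam.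
  apply/max_idPr; rewrite divr_ge0 ?(ltW lam0) //.
  have -> : ln N - ln 4 - ln k = ln N - ln (4 * k) by rewrite lnM ?posrE //; ring.
  by rewrite subr_ge0 ler_ln ?posrE; lra.
have g0 := @growth_bounds R.
set g := growth R in g0.
pose G := lnln (cutoff R n) - lnln (1 / 2) : R.
(* Jensen's inequality through the tangent of [ln] at [k * g]; the mean size is at most [k * g]
   because [q] is at least [1/e]. *)
apply: (@le_trans _ _ (rmean (fun r : round n => ((ln N - ln 4 - ln k - lam + 1) / lam + G) +
   (- (lam * k * g)^-1) * #|step S r|%:R))); last first.
  apply: le_rmean => r; have /andP[M0 Mk] := @nmissed_le R _ S r; fold k in Mk.
  set M := nmissed S r in M0 Mk.
  have sE : #|step S r|%:R = 2 * k - M :> R by rewrite stepE.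
  set s : R := #|step S r|%:R in sE *.
  rewrite /low /low_late -/N -/s lateE; last lra.
  rewrite -/G [leRHS]addrC -[leLHS]addrA [leLHS]addrCA [leLHS]addrC.
  suff h : (ln N - ln 4 - ln k - lam + 1) / lam + - (lam * k * g)^-1 * s <=
           low_early R n #|step S r| by lra.
  rewrite /low_early le_max; apply/orP; right; rewrite -/s -/N -/lam.
  have kg0 : 0 < k * g by rewrite mulr_gt0 //; lra.
  have s0 : 0 < s by lra.
  have := ln_le_tangent kg0 s0; rewrite lnM ?posrE //; last lra.
  rewrite -/lam => h.
  have -> : (ln N - ln 4 - ln k - lam + 1) / lam + - (lam * k * g)^-1 * s =
     (ln N - ln 4 - (ln k + lam + (s - k * g) / (k * g))) / lam.
    by field; rewrite !gt_eqF //; lra.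
  by rewrite ler_wpM2r ?invr_ge0 ?(ltW lam0) //; lra.
rewrite rmeanD rmean_cst rmeanZ (rmean_step S) -/k -/q.
rewrite /low earlyE /low_late -/N -/k lateE -/G; last lra.
have : (lam * k * g)^-1 * (2 * k - k * q) <= lam^-1.
  have -> : (lam * k * g)^-1 * (2 * k - k * q) = lam^-1 * ((2 - q) / g).
    by field; rewrite !gt_eqF //; lra.
  rewrite ler_piMr ?invr_ge0 ?(ltW lam0) // ler_pdivrMr; last lra.
  have := @miss_ge_expR1 R _ _ n1 S0; rewrite -/q mul1r /g /growth; lra.
have -> : (ln N - ln 4 - ln k - lam + 1) / lam = (ln N - ln 4 - ln k) / lam - 1 + lam^-1.
  by field; rewrite gt_eqF.
lra.
Qed.

Lemma low_late_drift : N <= 4 * k ->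
  low R n #|S| - (1 + 4 * low_range R n / expR (ln N / 4)) <=
  rmean (fun r => low R n #|step S r|).
Proof.
move=> late; have k0 : 0 < k by apply: lt_le_trans k1.
have N0 : 0 < N by have := N16; lra.
have kN' := kN; have k1' := k1.
have /andP[c0 c2] := @cutoff_bounds R n n16; set c := cutoff R n in c0 c2.
have /andP[G0 _] := @low_range_bounds R n n16; set G := low_range R n in G0 *.
have early0 : low_early R n #|S| = 0.
  apply/max_idPl; rewrite pmulr_lle0 ?invr_gt0 //.
  have : ln N <= ln (4 * k) by rewrite ler_ln ?posrE; lra.
  by rewrite lnM ?posrE // -/N -/k; lra.
have w0 : 0 < expR (ln N / 4) by exact: expR_gt0.
have loss0 : 0 <= 4 * G / expR (ln N / 4) by rewrite divr_ge0 ?mulr_ge0 // ltW.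
have low0 r : 0 <= low R n #|step S r|.
  rewrite addr_ge0 //; first by rewrite /low_early le_max lexx.
  by case/andP: (@low_late_bounds R n n16 #|step S r|).
have := @x_bounds R _ _ n1 S0; rewrite -/N -/k -/x => /andP[x0 x1].
have lowE : low R n #|S| = lnln c - lnln (clamp n x).
  by rewrite /low early0 add0r.
have [xc|cx] := leP x c.
  have -> : low R n #|S| = 0.
    rewrite lowE /clamp (max_idPl _) ?subrr //.
    by rewrite ge_min -/c xc.
  apply: (@le_trans _ _ (rmean (fun=> 0 : R) (n := n))); last exact: le_rmean.
  by rewrite rmean_cst; lra.
set u := N - k; have u0 : 0 < u by rewrite /u; lra.
have xE : x = u / N by [].
(* Chebyshev weight: a deviation of [u ^+ 2 / (2 * N)], half of the mean bound below, is charged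
   exactly the full range [G]. *)
pose B := 4 * N ^+ 2 / u ^+ 4 * G.
have B0 : 0 <= B by rewrite mulr_ge0 // divr_ge0 ?mulr_ge0 ?exprn_ge0 // ltW.
have mean : u ^+ 2 / N <= N - 2 * k + k * q.
  have := @miss_ge_lin R _ _ n1 S0; rewrite -/N -/k -/x -/q => hq.
  have : k * (1 - x) <= k * q by rewrite ler_wpM2l // ltW.
  have -> : u ^+ 2 / N = N - 2 * k + k * (1 - x).
    by rewrite /x /u; field; rewrite gt_eqF.
  by lra.
apply: (@le_trans _ _ (low R n #|S| - 1 + 0 * (k * q) - B * (k * q * (1 - q)))); last first.
  apply: ge_rmean_missed => // r; rewrite mul0r addr0 -/k -/q.
  have sE : #|step S r|%:R = 2 * k - nmissed S r :> R by rewrite stepE.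
  set M := nmissed S r in sE *.
  have x20 : 0 < x ^+ 2 / 2 by rewrite divr_gt0 ?exprn_gt0.
  have x21 : x ^+ 2 / 2 <= 1 / 2.
    by rewrite ler_wpM2r // expr_le1 // ltW.
  have lowSr : lnln c - lnln (clamp n ((N - (2 * k - M)) / N)) <= low R n #|step S r|.
    by rewrite /low /low_late -/N sE -/c lerDr /low_early le_max lexx.
  (* If the new fraction is at least [x ^+ 2 / 2], [lnln] grows by at most 1; otherwise the whole
     potential may be lost, and the deviation term pays. *)
  have [ok|bad] := leP (u ^+ 2 / (2 * N)) (N - (2 * k - M)).
    have : lnln (clamp n ((N - (2 * k - M)) / N)) <= 1 + lnln (clamp n x).
      have /andP[cl1 cl2] := @clamp_bounds R n n16 x.
      have /andP[dl1 dl2] := @clamp_bounds R n n16 ((N - (2 * k - M)) / N).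
      apply: (@le_trans _ _ (lnln (x ^+ 2 / 2))).
        apply: lnln_anti => //; last lra.
        rewrite /clamp le_max; apply/orP; right; rewrite le_min x21 andbT.
        have -> : x ^+ 2 / 2 = u ^+ 2 / (2 * N) / N by rewrite xE; field; rewrite gt_eqF.
        by rewrite ler_wpM2r // invr_ge0 ltW.
      rewrite lnln_sqr // ?lerD2l; last exact: ltW.
      apply: lnln_anti => //; last by rewrite ltW.
        by apply: lt_le_trans cl1.
      by rewrite /clamp ge_max (ltW cx) ge_min lexx.
    have : 0 <= B * (M - k * q) ^+ 2 by rewrite mulr_ge0 ?sqr_ge0.
    by rewrite lowE; lra.
  have dev : u ^+ 2 / (2 * N) <= k * q - M.
    have -> : u ^+ 2 / (2 * N) = u ^+ 2 / N - u ^+ 2 / (2 * N) by field; rewrite gt_eqF.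
    lra.
  have : G <= B * (M - k * q) ^+ 2.
    have -> : G = B * (u ^+ 2 / (2 * N)) ^+ 2 by rewrite /B; field; rewrite !gt_eqF.
    rewrite ler_wpM2l // -[leRHS]sqrrN; apply: lerXn2r; rewrite ?nnegrE.
    - by rewrite divr_ge0 ?exprn_ge0 ?mulr_ge0 // ltW.
    - apply: le_trans (_ : u ^+ 2 / (2 * N) <= _); last lra.
      by rewrite divr_ge0 ?exprn_ge0 ?mulr_ge0 // ltW.
    - lra.
  have : low R n #|S| <= G.
    have /andP[_] := @low_late_bounds R n n16 #|S|.
    by rewrite /low early0 add0r.
  by have := low0 r; lra.
(* The variance is at most [u], and [N * x ^+ 3] exceeds [N * c ^+ 3], which is [n ^ (1 / 4)]. *)
have loss : B * (k * q * (1 - q)) <= 4 * G / expR (ln N / 4).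
  have q01 : 0 <= q <= 1 by exact: miss_bounds.
  have hq : 1 - q <= x.
    by have := @miss_ge_lin R _ _ n1 S0; rewrite -/N -/k -/x -/q; lra.
  have kq : k * q * (1 - q) <= u.
    have : q * (1 - q) <= x.
      by apply: le_trans hq; rewrite ler_piMl; lra.
    move=> /(ler_wpM2l (ltW k0)); rewrite mulrA => /le_trans; apply.
    rewrite xE mulrA ler_pdivrMr // mulrC ler_wpM2l ?(ltW u0) //; lra.
  apply: le_trans (ler_wpM2l B0 kq) _.
  have -> : B * u = 4 * G * (N * x ^+ 3)^-1.
    by rewrite /B xE; field; rewrite !gt_eqF.
  have Nx0 : 0 < N * x ^+ 3 by apply: mulr_gt0 N0 _; exact: exprn_gt0.
  rewrite ler_wpM2l ?mulr_ge0 // lef_pV2 ?posrE //.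
  have -> : expR (ln N / 4) = N * c ^+ 3.
    transitivity (expR (ln N) * c ^+ 3); last by rewrite lnK ?posrE.
    rewrite /c /cutoff -/N -expRM_natl -expRD.
    by congr expR; lra.
  rewrite ler_wpM2l ?(ltW N0) //; apply: lerXn2r; rewrite ?nnegrE; lra.
rewrite mul0r addr0; move: loss.
set Y := B * _; set X := _ / expR _; set Z := low R n _.
lra.
Qed.

Lemma low_drift :
  low R n #|S| - (1 + 4 * low_range R n / expR (ln N / 4)) <=
  rmean (fun r => low R n #|step S r|).
Proof.
have [early|late] := ltP (4 * k) N; last exact: low_late_drift.
have : 0 <= 4 * low_range R n / expR (ln N / 4).
  have /andP[G0 _] := @low_range_bounds R n n16.
  by rewrite divr_ge0 ?mulr_ge0 ?expR_ge0.
by have := low_early_drift early; lra.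
Qed.

End LowerDrift.

(** With [l = ln n / 4], a relative error [O(l / expR l)] over a time [O(l)] totals [O(1)]: [expR l]
    dominates the quadratic. *)
Lemma loss_bound {R : realType} (l G U a b : R) : 0 <= l -> 0 <= a -> 0 <= b ->
  0 <= G <= 1 + 2 * l -> U <= a * l + b -> 4 * G / expR l * U <= 32 * (a + b).
Proof.
move=> l0 a0 b0 /andP[G0 Gl] Ul; have w0 := expR_gt0 l.
have w := expR_ge_sqr l0.
rewrite mulrAC ler_pdivrMr //.
apply: (@le_trans _ _ (4 * (1 + 2 * l) * ((a + b) * (1 + l)))).
  apply: (@le_trans _ _ (4 * G * ((a + b) * (1 + l)))).
    rewrite ler_wpM2l ?mulr_ge0 //; apply: le_trans Ul _.
    have : 0 <= b * l by rewrite mulr_ge0.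
    by lra.
  by rewrite ler_wpM2r ?mulr_ge0; lra.
have -> : 4 * (1 + 2 * l) * ((a + b) * (1 + l)) =
  4 * (a + b) * (1 + 3 * l + 2 * l ^+ 2) by ring.
have -> : 32 * (a + b) * expR l = 4 * (a + b) * (8 * expR l) by ring.
by rewrite ler_wpM2l ?mulr_ge0 ?addr_ge0 //; lra.
Qed.

(** * Both bounds combined *)

Theorem theorem68 (R : realType) :
  exists (C : R) (N : nat),
    forall n : nat, (N <= n)%N ->
    forall (d : measure_display) (Omega : measurableType d)
      (P : probability Omega R) (X : nat -> Omega -> round n) (v0 : 'I_n),
      iid_uniform P X ->
      (`| expected_spreading_time P v0 X
          - (log_base (2 - (expR 1)^-1) n%:R + log_base 2 (ln n%:R))%:E |
       <= C%:E)%E.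
Proof.
pose lam : R := ln (growth R).
have lam0 : 0 < lam by exact: ln_growth_gt0.
have ln2 := @ln2_ge R.
pose Ku : R := 2048 / lam + 2.
pose Kl : R := ln 4 / lam + 2 + lnln (1 / 2).
have Ku0 : 0 <= Ku.
  have : 0 <= 2048 / lam by apply: divr_ge0 (ltW lam0); lra.
  by rewrite /Ku; lra.
(* Chosen so that [a * (ln n / 4)] is [ln n / lam + 2 * ln n], which bounds the claimed time. *)
pose a : R := 4 / lam + 8.
have a0 : 0 <= a by rewrite addr_ge0 // divr_ge0 // ltW.
(* The upper deviation is at most [Ku]; the lower one is at most [|Kl|] plus the excess [eps * e],
   bounded through [e <= T + Ku]. *)
exists (Ku + `|Kl| + 32 * (a + Ku)), 64%N.
move=> n n64 d Omega P X v0 iidX.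
have n16 : (16 <= n)%N by apply: leq_trans n64.
have N64 : 64 <= n%:R :> R by rewrite (ler_nat _ 64).
have lnN1 : 1 <= ln n%:R :> R by apply: le1_ln; lra.
have cardS (S : {set 'I_n}) : (#|S| <= n)%N.
  by have := max_card (mem S); rewrite card_ord.
have G01 := @low_range_bounds R n n16.
pose eps : R := 4 * low_range R n / expR (ln n%:R / 4).
have eps0 : 0 <= eps.
  by case/andP: G01 => ? _; rewrite divr_ge0 ?mulr_ge0 ?expR_ge0.
have [e [-> eup elow]] : exists e : R, [/\ expected_spreading_time P v0 X = e%:E,
    e <= up R n 1 & low R n 1 <= (1 + eps) * e].
  apply: (expected_spreading_time_bounds (M := ln n%:R / lam + low_range R n) v0 iidX).
  - by move=> S S0; apply: up_ge0; rewrite ?S0 ?cardS.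
  - by move=> S S0; apply: up_drift.
  - exact: low_n.
  - by rewrite addr_ge0.
  - by move=> S S0; apply: low_le.
  - by move=> S S0; apply: low_drift.
rewrite /log_base -/(growth R) -/lam -EFinB abse_EFin lee_fin.
have := up1_le n64 lnN1; rewrite -/lam -/Ku => up1.
have := @low1_ge R n n16; rewrite -/lam -/Kl => low1.
set T : R := _ + ln (ln n%:R) / ln 2 in up1 low1 *.
have loss : eps * (T + Ku) <= 32 * (a + Ku).
  apply: loss_bound => //; [lra|lra|].
  rewrite /T lerD2r /a.
  have : ln (ln n%:R) / ln 2 <= 2 * ln n%:R :> R.
    rewrite ler_pdivrMr; last lra.
    apply: le_trans (ltW (ln_sublinear _)) _; first lra.
    have : 0 <= ln n%:R * (2 * ln 2 - 1) :> R by rewrite mulr_ge0; lra.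
    by lra.
  have -> : (4 / lam + 8) * (ln n%:R / 4) = ln n%:R / lam + 2 * ln n%:R.
    by field; rewrite gt_eqF.
  by lra.
have epse : eps * e <= eps * (T + Ku) by rewrite ler_wpM2l //; lra.
have Kla := ler_norm Kl.
rewrite ler_norml; apply/andP; split; last by have := normr_ge0 Kl; lra.
by lra.
Qed.
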